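(* Let $P\subset\mathbb R^n$ be a polytope containing $0$ in its interior, with Ricci affine function $\ell=\ell_P$. The following are equivalent: (1) the modified Ding functional $D_\ell$ is coercive; (2) $P$ is uniformly relative D-stable; (3) $\inf_P\ell_P>0$. Moreover, if they hold, the coercivity threshold of $D_\ell$ and the stability threshold of $P$ are both equal to $V_P\cdot\inf_P\ell_P$.
   Context: $V_P$ is the Lebesgue volume of $P$. $\psi_P(x)=\sup_{y\in P}\langle x,y\rangle$; $\phi^*(y)=\sup_{x}(\langle x,y\rangle-\phi(x))$; $\mathrm{PSH}(P)=\{\phi:\mathbb R^n\to\mathbb R\text{ convex}\mid\phi\le\psi_P+C\text{ for some }C\}$; $\mathcal E^1(P)=\{\phi\in\mathrm{PSH}(P)\mid\int_P\phi^*dy<\infty\}$. The Ricci affine function $\ell_P$ is the unique affine function with $-h(0)+\int_Ph\,\ell_P\,dy=0$ for all affine $h$. The modified Ding functional is $D_\ell(\phi)=-\log\int_{\mathbb R^n}e^{-\phi}dx+\int_P\phi^*\ell\,dy$ on $\mathcal E^1(P)$. For integrable convex $f$ on $P$: $D_\ell^{\mathrm{NA}}(f)=-f(0)+\int_Pf\,\ell\,dy$ and $J^T(f)=\inf\{\frac1{V_P}\int_P(f-l)dy-\inf_P(f-l)\mid l\text{ affine}\}$. For $\phi\in\mathcal E^1(P)$, $J^T(\phi)=\inf\{\frac1{V_P}\int_P(\phi^*-l)dy-\inf_P(\phi^*-l)\mid l\text{ affine}\}$. For $\delta>0$, $D_\ell$ is $\delta$-coercive if there is a constant $C_\delta$ with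 $D_\ell(\phi)\ge\delta J^T(\phi)-C_\delta$ for all $\phi\in\mathcal E^1(P)$; coercive means $\delta$-coercive for some $\delta>0$; the coercivity threshold is the supremum of such $\delta$. $P$ is $\delta$-uniformly relative D-stable if $D_\ell^{\mathrm{NA}}(f)\ge\delta J^T(f)$ for all rational piecewise linear convex $f$ on $P$ (maxima of finitely many affine functions with rational coefficients); uniformly relative D-stable means this for some $\delta>0$; the stability threshold is the supremum of such $\delta$. *)

(* Defs.v *)
From HB Require Import structures.
From mathcomp Require Import all_boot all_order all_algebra.
From mathcomp Require Import all_classical all_reals all_analysis.

Set Implicit Arguments.
Unset Strict Implicit.
Unset Printing Implicit Defensive.

Import Order.TTheory GRing.Theory Num.Theory.
Import numFieldNormedType.Exports.

Local Open Scope classical_set_scope.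
Local Open Scope ring_scope.

Definition rV_display : measure_display. Proof. exact: default_measure_display. Qed.

(** The Borel sigma-algebra of [R^n], generated by the coordinate functions. *)
Section measurable_rV.
Context {R : realType} {n : nat}.

Definition rV_coord (i : 'I_n) (x : 'rV[R]_n) : R := x ord0 i.

Let rV_set0 : g_sigma_preimage rV_coord set0.
Proof. exact: sigma_algebra0. Qed.

Let rV_setC A : g_sigma_preimage rV_coord A -> g_sigma_preimage rV_coord (~` A).
Proof. exact: sigma_algebraC. Qed.

Let rV_bigcup (F : _^nat) : (forall i, g_sigma_preimage rV_coord (F i)) ->
  g_sigma_preimage rV_coord (\bigcup_i (F i)).
Proof. exact: sigma_algebra_bigcup. Qed.

HB.instance Definition _ := @isMeasurable.Build rV_display
  'rV[R]_n (g_sigma_preimage rV_coord) rV_set0 rV_setC rV_bigcup.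

Lemma measurable_rV_coord (i : 'I_n) :
  measurable_fun [set: 'rV[R]_n] (fun x => x ord0 i).
Proof.
move=> _ Y mY; rewrite setTI; apply: sub_sigma_algebra => /=.
rewrite -bigcup_seq/=; exists i => /=; first by rewrite mem_index_enum.
by exists Y => //; rewrite setTI.
Qed.

Lemma measurable_fun_rV d (T : measurableType d) (f : T -> 'rV[R]_n) :
  (forall i, measurable_fun [set: T] (fun x => f x ord0 i)) ->
  measurable_fun [set: T] f.
Proof.
move=> mf _ Y mY; rewrite setTI.
suff H : @g_sigma_preimage _ R 'rV[R]_n n rV_coord `<=`
  [set A | measurable (f @^-1` A)].
  exact: (H _ mY).
apply: smallest_sub; first split.
- by rewrite /= preimage_set0.
- by move=> A /= mA; rewrite setTD preimage_setC; exact: measurableC.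
- by move=> F mF /=; rewrite preimage_bigcup; exact: bigcupT_measurable.
rewrite -bigcup_seq/=; apply: bigcup_sub => i _ _ [B mB <-] /=.
by rewrite setTI; have := mf i measurableT B mB; rewrite setTI.
Qed.

End measurable_rV.

Section lebesgue_rV.
Context {R : realType}.

Definition rV_cons n (p : measurableTypeR R * 'rV[R]_n) : 'rV[R]_n.+1 :=
  row_mx (p.1)%:M p.2 : 'rV[R]_(1 + n).

Lemma rV_cons0 n p : @rV_cons n p ord0 ord0 = p.1.
Proof.
rewrite /rV_cons mxE; case: splitP => [j|k] //= _.
by rewrite (ord1 j) mxE eqxx mulr1n.
Qed.

Lemma rV_consS n p i : @rV_cons n p ord0 (lift ord0 i) = p.2 ord0 i.
Proof.
rewrite /rV_cons mxE; case: splitP => [j|k] /= ij.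
  by have := ltn_ord j; rewrite -ij.
by congr (p.2 _ _); apply/val_inj; apply: succn_inj.
Qed.

Lemma measurable_rV_cons n :
  measurable_fun [set: measurableTypeR R * 'rV[R]_n] (@rV_cons n).
Proof.
apply: measurable_fun_rV => i.
have [->|[j ->]] : i = ord0 \/ exists j, i = lift ord0 j.
- by have := unliftP ord0 i => -[j ->|->]; [right; exists j|left].
- by under eq_fun do rewrite rV_cons0; exact: measurable_fst.
- under eq_fun do rewrite rV_consS.
  exact: (measurableT_comp (measurable_rV_coord j) measurable_snd).
Qed.



Definition rV_behead n (x : 'rV[R]_n.+1) : 'rV[R]_n :=
  \row_i x ord0 (lift ord0 i).

Lemma rV_consK n p : rV_behead (@rV_cons n p) = p.2.
Proof. by apply/rowP => i; rewrite mxE rV_consS. Qed.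

Lemma measurable_rV_behead n : measurable_fun [set: 'rV[R]_n.+1] (@rV_behead n).
Proof.
apply: measurable_fun_rV => i; under eq_fun do rewrite mxE.
exact: measurable_rV_coord.
Qed.

Section step.
Variables (n : nat) (mu : {sigma_finite_measure set 'rV[R]_n -> \bar R}).

Definition lebesgue_rV_step : set 'rV[R]_n.+1 -> \bar R :=
  pushforward ((@lebesgue_measure R) \x mu)%E (@rV_cons n).

Let m : {measure set 'rV[R]_n.+1 -> \bar R} :=
  measure_function_pushforward__canonical__measure_function_Measure
    ((@lebesgue_measure R) \x mu)%E (@measurable_rV_cons n).

HB.instance Definition _ := isMeasure.Build _ _ _ lebesgue_rV_step
  (measure0 m) (measure_ge0 m) (@measure_semi_sigma_additive _ _ _ m).

Let step_sigma_finite : sigma_finite setT lebesgue_rV_step.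
Proof.
have [F TF Foo] : sigma_finite setT ((@lebesgue_measure R) \x mu)%E.
  have /sigma_finiteP[F [TF ndF Foo]] := sigma_finiteT (@lebesgue_measure R).
  have /sigma_finiteP[G [TG ndG Goo]] := sigma_finiteT mu.
  exists (fun n => F n `*` G n).
    rewrite -setXTT TF TG predeqE => -[x y]; split.
      move=> [/= [i _ Fnx] [k _ Gky]]; exists (maxn i k) => //; split.
      - by move: x Fnx; exact/subsetPset/ndF/leq_maxl.
      - by move: y Gky; exact/subsetPset/ndG/leq_maxr.
    by move=> [i _ []/= ? ?]; split; exists i.
  move=> k; have [? ?] := Foo k; have [? ?] := Goo k.
  split; first exact: measurableX.
  by rewrite product_measure1E// lte_mul_pinfty// ge0_fin_numE.
pose u (x : 'rV[R]_n.+1) : measurableTypeR R * 'rV[R]_n :=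
  (x ord0 ord0, rV_behead x).
have uK p : u (rV_cons p) = p.
  by rewrite /u rV_cons0 rV_consK; case: p.
have mu_ : measurable_fun [set: 'rV[R]_n.+1] u.
  apply/measurable_fun_pairP; split.
    exact: measurable_rV_coord.
  exact: measurable_rV_behead.
exists (fun k => u @^-1` F k).
  by rewrite -preimage_bigcup -TF preimage_setT.
move=> k; have [mF Fk] := Foo k; split.
  by rewrite -[X in measurable X]setTI; exact: mu_.
rewrite /lebesgue_rV_step /pushforward -comp_preimage.
by rewrite (_ : u \o _ = id)//; apply/funext.
Qed.

HB.instance Definition _ := Measure_isSigmaFinite.Build _ _ _
  lebesgue_rV_step step_sigma_finite.

End step.

(** Lebesgue measure on [R^n], as an iterated product of [lebesgue_measure];
    see [lebesgue_rV_prod] for its value on product sets. *)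
Fixpoint lebesgue_rV n : {sigma_finite_measure set 'rV[R]_n -> \bar R} :=
  match n with
  | 0 => \d_(0 : 'rV[R]_0)
  | m.+1 => lebesgue_rV_step (lebesgue_rV m)
  end.

Lemma lebesgue_rV_prod n (A : 'I_n -> set (measurableTypeR R)) :
  (forall i, measurable (A i)) ->
  lebesgue_rV n [set x | forall i, A i (x ord0 i)] =
  (\prod_(i < n) lebesgue_measure (A i))%E.
Proof.
elim: n A => [|n IH] A mA /=.
  rewrite big_ord0 diracE mem_set//= => -[] //.
rewrite /lebesgue_rV_step /pushforward big_ord_recl.
rewrite (_ : _ @^-1` _ = A ord0 `*`
  [set x : 'rV[R]_n | forall i, A (lift ord0 i) (x ord0 i)]).
  rewrite product_measure1E//; first by congr (_ * _)%E; exact: IH.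
  rewrite (_ : mkset _ = \bigcap_(i in [set: 'I_n])
    ((fun x : 'rV[R]_n => x ord0 i) @^-1` A (lift ord0 i))).
    apply: fin_bigcap_measurable => // i _.
    rewrite -[X in measurable X]setTI.
    exact: (measurable_rV_coord i measurableT (mA _)).
  by apply/seteqP; split => x /= h i; [move=> _; exact: h|exact: (h i I)].
apply/seteqP; split => [x /= h|x /= [h0 hS] i].
  by split; [rewrite -(rV_cons0 x)|move=> i; rewrite -(rV_consS x)]; exact: h.
have := unliftP ord0 i => -[j ->|->]; first by rewrite rV_consS; exact: hS.
by rewrite rV_cons0.
Qed.

End lebesgue_rV.

Section ding.
Context {R : realType} {n : nat}.
Implicit Types (P : set 'rV[R]_n) (x y : 'rV[R]_n).
Implicit Types (phi f l h : 'rV[R]_n -> R) (F : 'rV[R]_n -> \bar R).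

Local Notation leb := (@lebesgue_rV R n).

Definition dot x y : R := \sum_(i < n) x ord0 i * y ord0 i.

Definition is_affine l := exists (a : 'rV[R]_n) (c : R), forall y, l y = dot a y + c.

Definition is_polytope P := exists (m : nat) (v : 'I_m -> 'rV[R]_n),
  P = [set x | exists w : 'I_m -> R,
    [/\ forall i, 0 <= w i, \sum_i w i = 1 & x = \sum_i w i *: v i]].

Definition volume P : R := fine (leb P).

Definition support_function P x : R := sup [set dot x y | y in P].

Definition legendre phi y : \bar R :=
  ereal_sup [set (dot x y - phi x)%:E | x in [set: 'rV[R]_n]].

Definition PSH P : set ('rV[R]_n -> R) := [set phi |
  convex_function (E := 'rV[R]_n) [set: 'rV[R]_n] phi /\
  exists C : R, forall x, phi x <= support_function P x + C].

Definition E1 P : set ('rV[R]_n -> R) := [set phi |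
  PSH P phi /\ (\int[leb]_(y in P) legendre phi y < +oo)%E].

(** When [P] is a polytope with [0] in its interior, exactly one function [l]
    satisfies this: the Ricci affine function of [P]. *)
Definition is_ricci_affine P l := is_affine l /\
  forall h, is_affine h ->
    ((- h 0)%:E + \int[leb]_(y in P) (h y * l y)%:E = 0)%E.

(** The functionals take values in [\bar R]; on [E1 P], resp. on piecewise linear
    functions, all the values involved are finite. *)
Definition ding P l phi : \bar R :=
  (- lne (\int[leb]_x (expR (- phi x))%:E)
   + \int[leb]_(y in P) (legendre phi y * (l y)%:E))%E.

Definition dingNA P l f : \bar R :=
  ((- f 0)%:E + \int[leb]_(y in P) (f y * l y)%:E)%E.

(** Extended-real valued argument, since [legendre phi] may be infinite on the
    boundary of [P]. *)
Definition JT P F : \bar R := ereal_inf [set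
  ((volume P)^-1%:E * \int[leb]_(y in P) (F y - (l y)%:E)
   - ereal_inf [set F y - (l y)%:E | y in P])%E | l in is_affine].

Definition coercive_with P l (delta : R) := exists C : R, forall phi, E1 P phi ->
  (delta%:E * JT P (legendre phi) - C%:E <= ding P l phi)%E.

Definition coercive P l := exists2 delta : R, 0 < delta & coercive_with P l delta.

(** Suprema in [\bar R], so that an unbounded set gets [+oo] and no default value. *)
Definition coercivity_threshold P l : \bar R :=
  ereal_sup [set delta%:E | delta in [set d : R | 0 < d /\ coercive_with P l d]].

(** Rational coefficients include the constant terms; [f] is only constrained on
    [P], outside of which no functional depends on it. *)
Definition rational_PL P f :=
  exists (m : nat) (a : 'I_m.+1 -> 'rV[rat]_n) (c : 'I_m.+1 -> rat),
  let g i y : R := dot (map_mx ratr (a i)) y + ratr (c i) in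
  forall y, P y -> f y = \big[Num.max/g ord0 y]_(i < m.+1) g i y.

Definition D_stable_with P l (delta : R) := forall f, rational_PL P f ->
  (delta%:E * JT P (EFin \o f) <= dingNA P l f)%E.

Definition uniformly_D_stable P l :=
  exists2 delta : R, 0 < delta & D_stable_with P l delta.

Definition stability_threshold P l : \bar R :=
  ereal_sup [set delta%:E | delta in [set d : R | 0 < d /\ D_stable_with P l d]].

End ding.

(* Main.v *)
Require Import Defs.
From mathcomp Require Import all_boot all_order all_algebra.
From mathcomp Require Import all_classical all_reals all_analysis.
From mathcomp Require Import measurable_realfun lra ring.

Set Implicit Arguments.
Unset Strict Implicit.
Unset Printing Implicit Defensive.

Import Order.TTheory GRing.Theory Num.Theory.
Import numFieldNormedType.Exports.

Local Open Scope classical_set_scope.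
Local Open Scope ring_scope.

(** Let [m] be the infimum of [l] on [P], [V] the volume and [b] the barycenter of
    [P]. The theorem follows from two facts, valid for stability and for coercivity
    alike: every positive [delta] smaller than [V m] is admissible, and every
    admissible [delta] is at most [V m].

    Everything rests on invariance under affine functions. The equation defining [l]
    says that the density [l] has total mass [1] and barycenter [0], so [D^NA] does
    not change when an affine function is added to [f]; neither does [J^T], and [D]
    does not change when one is added to [phi^*]. Moreover [J^T f] is the mean of [f]
    minus [f b] for convex [f]: Jensen's inequality at [b] gives the lower bound
    ([JT_ge]), for which [b] must belong to [P] ([barycenter_in]).

    Admissible values are at most [V m]. Take [f = max 0 u] with [u] rational affine,
    positive only where [l <= m + e] and nonpositive at [0] and at [b]
    ([test_function]). Then [J^T f] is at least the mean of [f], whereas [D^NA f] is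
    the integral of [f l], at most [(m + e)] times the integral of [f]. For
    coercivity, the same inequality is the slope at infinity of [D] and [J^T] along
    the potentials whose Legendre transforms are the multiples [s f] on [P]
    ([coercive_inf_ge]).

    Small values are admissible. For stability, subtract from [f] the affine piece
    that is active at [0]: then [f >= 0 = f 0], and [D^NA f], the integral of [f l],
    is at least [m] times the integral of [f] ([D_stable_le_inf]). For coercivity,
    subtract from [phi^*] the affine function given by an almost minimum point of
    [phi], which makes [phi^*] nonnegative with integral [E] on [P]. The second term
    of [D] is then at least [m E], while [J^T] is at most [E / V]. With [x0] that
    point, it remains to bound the integral of [exp (phi x0 - phi)] by
    [C_t exp (C t E)] for arbitrarily small [t > 0], where [C] depends on [P] only:
    this follows from the growth of [phi] forced by the size of [E]
    ([energy_growth], [coercive_lt_inf]). *)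

(** * Borel sets and boxes in R^n *)

Section borel_rV.
Context {R : realType}.
Local Notation leb n := (@lebesgue_rV R n).

Lemma measurable_rV_prod n (A : 'I_n -> set (measurableTypeR R)) :
  (forall i, measurable (A i)) ->
  measurable [set x : 'rV[R]_n | forall i, A i (x ord0 i)].
Proof.
move=> mA; rewrite (_ : mkset _ = \bigcap_(i in [set: 'I_n])
    ((fun x : 'rV[R]_n => x ord0 i) @^-1` A i)).
  apply: fin_bigcap_measurable => // i _.
  rewrite -[X in measurable X]setTI.
  exact: (measurable_rV_coord i measurableT (mA _)).
by apply/seteqP; split => x /= h i; [move=> _; exact: h|exact: (h i I)].
Qed.

Lemma rV_ballE n (x : 'rV[R]_n) e y : 0 < e ->
  ball x e y <-> forall i, `|x ord0 i - y ord0 i| < e.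
Proof.
move=> e0; split=> [[_ h] i|h]; first exact: (h ord0 i).
by split => // i j; rewrite (ord1 i); exact: h.
Qed.

Definition box n (a b : 'rV[R]_n) : set 'rV[R]_n :=
  [set x | forall i, a ord0 i <= x ord0 i <= b ord0 i].

Lemma boxE n (a b : 'rV[R]_n) : box a b =
  [set x | forall i, ([set` `[a ord0 i, b ord0 i]] : set (measurableTypeR R)) (x ord0 i)].
Proof. by apply/seteqP; split => x /= h i; have := h i; rewrite /= in_itv. Qed.

Lemma measurable_box n (a b : 'rV[R]_n) : measurable (box a b).
Proof.
rewrite boxE; apply: (measurable_rV_prod (A := fun i => [set` `[a ord0 i, b ord0 i]])).
by move=> i; exact: measurable_itv.
Qed.

Lemma lebesgue_box n (a b : 'rV[R]_n) :
  (forall i, a ord0 i <= b ord0 i) ->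
  leb n (box a b) = (\prod_(i < n) (b ord0 i - a ord0 i))%:E.
Proof.
move=> ab; rewrite boxE (lebesgue_rV_prod (A := fun i => [set` `[a ord0 i, b ord0 i]])); last first.
  by move=> i; exact: measurable_itv.
rewrite -prodEFin; apply: eq_bigr => i _.
rewrite lebesgue_measure_itv/= lte_fin.
have := ab i; rewrite le_eqVlt => /predU1P[->|->]; first by rewrite ltxx subrr.
by rewrite -EFinD.
Qed.

(** An open set is the union of the cubes with rational centres and sides [2/(k+1)]
    that it contains, and there are countably many of these. Used for the
    measurability of convex bodies and of Legendre transforms. *)
Lemma open_measurable_rV n (U : set 'rV[R]_n) : open U -> measurable U.
Proof.
move=> oU.
pose I (p : 'rV[rat]_n * nat) i : set (measurableTypeR R) :=
  [set` `]ratr (p.1 ord0 i) - p.2.+1%:R^-1, ratr (p.1 ord0 i) + p.2.+1%:R^-1[].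
pose cube p : set 'rV[R]_n := [set y | forall i, I p i (y ord0 i)].
have mcube p : measurable (cube p).
  by apply: measurable_rV_prod => i; exact: measurable_itv.
rewrite (_ : U = \bigcup_(p in [set p | cube p `<=` U]) cube p); last first.
  apply/seteqP; split => [x Ux|x [p /= pU /pU //]].
  have /nbhs_ballP[e /= e0 eU] : nbhs x U by exact: open_nbhs_nbhs.
  have [k] : exists k, 0 + k.+1%:R^-1 < e / 2.
    by apply: ltr_add_invr; rewrite divr_gt0.
  have kgt : (0 : R) < k.+1%:R^-1 by rewrite invr_gt0.
  rewrite add0r; move: kgt; set r := k.+1%:R^-1 => r0 re.
  have hq i : exists q : rat, `|ratr q - x ord0 i| < r.
    have [|q] := @rat_in_itvoo R (x ord0 i) (x ord0 i + r).
      by rewrite ltrDl.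
    rewrite in_itv/= => /andP[q1 q2]; exists q.
    by rewrite ltr_norml; apply/andP; split; lra.
  have [q qP] := choice hq.
  exists (\row_i q i, k) => /=.
    move=> y /= hy; apply: eU; apply/rV_ballE => // i.
    have := hy i; have := qP i; rewrite /I /= in_itv /= mxE -/r ltr_norml.
    move=> /andP[h1 h2] /andP[h3 h4].
    by rewrite ltr_norml; apply/andP; split; lra.
  move=> i; rewrite /I /= in_itv /= mxE -/r; have := qP i; rewrite ltr_norml.
  by move=> /andP[h1 h2]; apply/andP; split; lra.
rewrite bigcup_mkcond; apply: countable_bigcupT_measurable => //.
by move=> p; case: ifPn.
Qed.

Lemma lower_semicontinuous_measurable_rV n (f : 'rV[R]_n -> \bar R) :
  lower_semicontinuous f -> measurable_fun [set: 'rV[R]_n] f.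
Proof.
move=> scif; apply: (measurability _ (ErealGenOInfty.measurableE R)).
move=> /= _ [_ [a ->]] <-; apply: measurableI => //.
apply: open_measurable_rV.
by rewrite preimage_itvoy; move/lower_semicontinuousP : scif; exact.
Qed.

Lemma lebesgue_open_gt0 n (U : set 'rV[R]_n) x :
  open U -> U x -> (0 < leb n U)%E.
Proof.
move=> oU Ux.
have /nbhs_ballP[e /= e0 eU] : nbhs x U by exact: open_nbhs_nbhs.
apply: (@lt_le_trans _ _ (leb n (box x (x + const_mx (e / 2))))).
  rewrite lebesgue_box => [|i]; last by rewrite !mxE lerDl divr_ge0// ltW.
  rewrite lte_fin prodr_gt0// => i _.
  by rewrite !mxE addrAC subrr add0r divr_gt0.
apply: le_measure; rewrite ?inE; [exact: measurable_box|exact: open_measurable_rV|].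
move=> y hy; apply: eU; apply/rV_ballE => // i.
have /andP[] := hy i; rewrite !mxE => h1 h2.
rewrite ltr_norml; apply/andP; split; lra.
Qed.

End borel_rV.

(** * Integrals of products and of exponentials *)

Section product_integrals.
Context {R : realType}.
Local Notation leb n := (@lebesgue_rV R n).
Local Open Scope ereal_scope.

(** The integral of a nonnegative function is a supremum over simple minorants,
    hence monotone on all nonnegative functions. It is applied to [exp (- phi)] for an
    arbitrary potential [phi]. *)
Lemma ge0_le_integralT d (T : measurableType d) (mu : {measure set T -> \bar R})
    (f g : T -> \bar R) : (forall x, 0 <= f x) -> (forall x, f x <= g x) ->
  \int[mu]_x f x <= \int[mu]_x g x.
Proof.
move=> f0 fg; have g0 x : 0 <= g x by exact: le_trans (f0 x) (fg x).
rewrite !ge0_integralTE//; apply: le_ereal_sup => _ [h /= hf <-].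
by exists h => //= x; exact: le_trans (hf x) (fg x).
Qed.

Lemma measurable_fun_coord n (i : 'I_n) (f : measurableTypeR R -> R) :
  measurable_fun setT f -> measurable_fun setT (fun x : 'rV[R]_n => f (x ord0 i)).
Proof.
move=> mf _ Y mY; rewrite setTI.
have mfY := mf measurableT Y mY; rewrite setTI in mfY.
by have := measurable_rV_coord i measurableT mfY; rewrite setTI.
Qed.

Lemma ge0_integral_rV_prod n (f : 'I_n -> measurableTypeR R -> R) :
  (forall i, measurable_fun setT (f i)) -> (forall i s, 0 <= f i s)%R ->
  \int[leb n]_x (\prod_(i < n) f i (x ord0 i))%:E =
  \prod_(i < n) \int[lebesgue_measure]_s (f i s)%:E.
Proof.
elim: n f => [|n IH] f mf f0.
  under eq_integral do rewrite big_ord0.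
  by rewrite integral_cst// big_ord0 mul1e/= diracE in_setT.
have mF : measurable_fun setT
    (fun x : 'rV[R]_n.+1 => (\prod_(i < n.+1) f i (x ord0 i))%:E).
  apply/measurable_EFinP; apply: measurable_prod => i _.
  exact: measurable_fun_coord.
rewrite [LHS](ge0_integral_pushforward (@measurable_rV_cons R n) _ measurableT mF); last first.
  by move=> y _; rewrite lee_fin prodr_ge0.
rewrite preimage_setT (fubini_tonelli1 (m1 := lebesgue_measure) (m2 := leb n))/=; last 2 first.
- exact: (measurableT_comp mF (@measurable_rV_cons R n)).
- by move=> p; rewrite lee_fin prodr_ge0.
rewrite big_ord_recl -(IH (fun i => f (lift ord0 i)))//.
transitivity (\int[lebesgue_measure]_s ((f ord0 s)%:E *
  \int[leb n]_x (\prod_(i < n) f (lift ord0 i) (x ord0 i))%:E)).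
  apply: eq_integral => s _; rewrite /fubini_F -ge0_integralZl_EFin//.
  - apply: eq_integral => y _; rewrite [in LHS]/= big_ord_recl rV_cons0 EFinM.
    by under eq_bigr do rewrite rV_consS.
  - by move=> y _; rewrite lee_fin prodr_ge0.
  - apply/measurable_EFinP; apply: measurable_prod => i _.
    exact: measurable_fun_coord.
rewrite ge0_integralZr//.
- apply/measurable_EFinP; exact: (mf ord0).
- by move=> s _; rewrite lee_fin.
- by apply: integral_ge0 => x _; rewrite lee_fin prodr_ge0.
Qed.

(** Translation and folding reduce this to the total mass of the exponential law. *)
Lemma integral_exp_abs (e a : R) : (0 < e)%R ->
  \int[lebesgue_measure]_s (expR (- (e * `|s - a|)))%:E = (2 / e)%:E.
Proof.
move=> e0.
have ca (b : R) : continuous (fun s : R => expR (- (e * `|s - b|))%R).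
  move=> s; apply: continuous_comp; last exact: continuous_expR.
  apply: (@continuousN _ R^o); apply: continuousM; first exact: cst_continuous.
  apply: continuous_comp; last exact: norm_continuous.
  by apply: (@continuousB _ R^o) => //; exact: cst_continuous.
have da : derive1 (fun x : R => x + a)%R = cst 1%R.
  apply/funext => x; rewrite derive1E deriveD//.
  by rewrite derive_id derive_cst addr0.
rewrite (increasing_ge0_integration_by_substitutionT (F := fun x => (x + a)%R)); last 9 first.
- by move=> x y; rewrite ltrD2r.
- by rewrite da; move=> x; exact: cst_continuous.
- by rewrite da; exact: is_cvg_cst.
- by rewrite da; exact: is_cvg_cst.
- by move=> x; exact: derivableD.
- exact: cvg_addrr_Ny.
- exact: cvg_addrr.
- exact: ca.
- by move=> x; exact: expR_ge0.
rewrite da.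
transitivity (\int[lebesgue_measure]_s (expR (- (e * `|s|)))%:E).
  by apply: eq_integral => x _; rewrite fctE /= mulr1 addrK.
rewrite ge0_symfun_integralT; last 3 first.
- by move=> x; exact: expR_ge0.
- by have := ca 0%R; under eq_fun do rewrite subr0.
- by move=> x /=; rewrite normrN.
have := integral_exponential_pdf e0.
rewrite (_ : (fun x => _) = (EFin \o (fun x => (e * expR (- e * x))%R)) \_ `[0%R, +oo[); last first.
  apply/funext => x; rewrite /exponential_pdf !patchE; by case: ifP.
rewrite -integral_mkcond set_itvcy.
under eq_integral do rewrite /= EFinM.
rewrite ge0_integralZl_EFin//; last 3 first.
- by rewrite -set_itvcy; exact: measurable_itv.
- apply/measurable_EFinP/measurable_funTS; apply: continuous_measurable_fun => s.
  apply: continuous_comp; last exact: continuous_expR.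
  by apply: continuousM => //; exact: cst_continuous.
- exact: ltW.
move=> eI.
pose J := \int[lebesgue_measure]_(x in [set x : R | (0 <= x)%R]) (expR (- e * x))%:E.
rewrite (_ : integral _ _ _ = J); last first.
  apply: eq_integral => x; rewrite inE /= => x0.
  by rewrite ger0_norm// mulNr.
have {eI} : e%:E * J = 1 by exact: eI.
move: J => [r| |].
- rewrite -!EFinM => -[er]; congr EFin.
  by apply: (mulfI (lt0r_neq0 e0)); rewrite mulrCA er mulrCA divff ?gt_eqF.
- by rewrite gt0_muley.
- by rewrite gt0_muleNy.
Qed.

End product_integrals.

(** * Affine functions and convex bodies *)

Section dot_products.
Context {R : realType} {n : nat}.
Implicit Types x y z a : 'rV[R]_n.

Lemma dotDl x y z : dot (x + y) z = dot x z + dot y z.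
Proof. by rewrite /dot -big_split; apply: eq_bigr => i _; rewrite mxE mulrDl. Qed.

Lemma dotZl (t : R) x y : dot (t *: x) y = t * dot x y.
Proof. by rewrite /dot mulr_sumr; apply: eq_bigr => i _; rewrite mxE mulrA. Qed.

Lemma dotC x y : dot x y = dot y x.
Proof. by apply: eq_bigr => i _; rewrite mulrC. Qed.

Lemma dotDr x y z : dot x (y + z) = dot x y + dot x z.
Proof. by rewrite dotC dotDl !(dotC x). Qed.

Lemma dotZr (t : R) x y : dot x (t *: y) = t * dot x y.
Proof. by rewrite dotC dotZl (dotC x). Qed.

Lemma dotNl x y : dot (- x) y = - dot x y.
Proof. by rewrite -scaleN1r dotZl mulN1r. Qed.

Lemma dotNr x y : dot x (- y) = - dot x y.
Proof. by rewrite dotC dotNl (dotC x). Qed.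

Lemma dot0r x : dot x 0 = 0.
Proof. by rewrite -(scale0r 0) dotZr mul0r. Qed.

Lemma dot0l x : dot 0 x = 0.
Proof. by rewrite dotC dot0r. Qed.

Lemma dot_ge0 x : 0 <= dot x x.
Proof. by apply: sumr_ge0 => i _; rewrite -expr2 sqr_ge0. Qed.

Lemma dot_eq0 x : dot x x = 0 -> x = 0.
Proof.
move=> /eqP; rewrite psumr_eq0; last by move=> i _; rewrite -expr2 sqr_ge0.
move=> /allP h; apply/rowP => i; rewrite mxE; apply/eqP.
by have := h i (mem_index_enum i); rewrite mulf_eq0 orbb.
Qed.

Lemma dot_continuous a : continuous (dot a).
Proof.
apply: continuous_big => [|i _]; first exact: add_continuous.
move=> x; apply: continuousM; first exact: cst_continuous.
exact: coord_continuous.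
Qed.

Lemma measurable_dot a D : measurable_fun D (dot a).
Proof.
apply: measurable_funTS; apply: measurable_sum => i.
apply: measurable_funM => //; exact: measurable_rV_coord.
Qed.

Lemma rV_norm_coord x i : `|x ord0 i| <= `|x|.
Proof.
rewrite [leRHS]/Num.norm /= mx_normrE.
exact: (le_bigmax _ (fun ij => `|x ij.1 ij.2|) (ord0, i)).
Qed.

Lemma affine_dot a (c : R) : is_affine (fun y => dot a y + c).
Proof. by exists a, c. Qed.

Lemma lower_semicontinuous_legendre (phi : 'rV[R]_n -> R) :
  lower_semicontinuous (legendre phi).
Proof.
move=> y a /ereal_sup_gt[_ [x _ <-]]; rewrite lte_fin => axy.
exists [set z | a < dot x z - phi x].
  apply: open_nbhs_nbhs; split => //.
  rewrite (_ : mkset _ = dot x @^-1` [set s | a + phi x < s]).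
    by move/continuousP : (@dot_continuous x); apply; exact: open_gt.
  by apply/seteqP; split => z /=; rewrite ltrBrDr.
move=> z /= az; apply: (@lt_le_trans _ _ (dot x z - phi x)%:E).
  by rewrite lte_fin.
by apply: ereal_sup_ubound; exists x.
Qed.

Lemma legendre_ge (phi : 'rV[R]_n -> R) x y :
  ((dot x y - phi x)%:E <= legendre phi y)%E.
Proof. by apply: ereal_sup_ubound; exists x. Qed.

Lemma measurable_legendre (phi : 'rV[R]_n -> R) D :
  measurable_fun D (legendre phi).
Proof.
apply: measurable_funTS; apply: lower_semicontinuous_measurable_rV.
exact: lower_semicontinuous_legendre.
Qed.

End dot_products.

Section convex_bodies.
Context {R : realType} {n : nat}.
Implicit Types (P : set 'rV[R]_n) (x y z a : 'rV[R]_n) (f g h l : 'rV[R]_n -> R).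
Local Notation leb := (@lebesgue_rV R n).

(** All that the argument requires of a polytope; convexity is written with
    [x + t (y - x)], the form in which segments are used below. *)
Definition convex_body P := [/\ compact P,
  forall x y (t : R), P x -> P y -> 0 <= t <= 1 -> P (x + t *: (y - x))
  & interior P 0].

(** Compactness: a polytope is the image of the standard simplex under the
    continuous map sending weights to convex combinations. *)
Lemma polytope_convex_body P : is_polytope P -> interior P 0 -> convex_body P.
Proof.
move=> [m [v PE]] P0; split => //.
  pose S := [set w : 'rV[R]_m | forall i, `[0, 1]%classic (w ord0 i)] `&`
    [set w | dot (const_mx 1) w = 1].
  have cS : compact S.
    apply: compact_closedI.
      by apply: (@rV_compact R m (fun=> `[0, 1]%classic)) => i; exact: segment_compact.
    have := @dot_continuous R m (const_mx 1).
    by move=> /continuous_closedP /(_ [set 1]); apply; exact: closed_eq.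
  rewrite (_ : P = (fun w : 'rV[R]_m => \sum_i w ord0 i *: v i) @` S).
    apply: continuous_compact => //; apply: continuous_subspaceT.
    apply: continuous_big => [|i _]; first exact: add_continuous.
    move=> w; apply: (@cvgZr_tmp _ _ _ (nbhs w) _ (fun w : 'rV[R]_m => w ord0 i)).
    exact: coord_continuous.
  rewrite PE; apply/seteqP; split => [x [w [w0 w1 ->]]|x [w [wi w1] <-]].
    exists (\row_i w i); last by apply: eq_bigr => i _; rewrite mxE.
    split=> /= [i|]; last by rewrite -[RHS]w1; apply: eq_bigr => i _; rewrite !mxE mul1r.
    rewrite in_itv /= mxE w0 /= -w1 (bigD1 i)//= lerDl.
    by apply: sumr_ge0 => j _; exact: w0.
  exists (w ord0); split => //.
  - by move=> i; have := wi i; rewrite /= in_itv /= => /andP[].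
  - by rewrite -[RHS]w1; apply: eq_bigr => i _; rewrite mxE mul1r.
move=> x y t; rewrite PE => -[w [w0 w1 ->]] [u [u0 u1 ->]] /andP[t0 t1].
exists (fun i => w i + t * (u i - w i)); split.
- move=> i; have := w0 i; have := u0 i => ui wi.
  rewrite (_ : _ + _ = (1 - t) * w i + t * u i); last by ring.
  by rewrite addr_ge0// mulr_ge0// subr_ge0.
- by rewrite big_split/= -mulr_sumr sumrB w1 u1 subrr mulr0 addr0.
- rewrite -sumrB scaler_sumr -big_split; apply: eq_bigr => i _ /=.
  by rewrite scalerDl -scalerBl scalerA.
Qed.

Lemma convex_body_bounded P : convex_body P ->
  exists2 M, 0 < M & forall y, P y -> forall i, `|y ord0 i| <= M.
Proof.
move=> [/compact_bounded[M [_ hM]] _ _].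
exists (`|M| + 1); first by rewrite ltr_pwDr.
move=> y Py i; apply: (le_trans (rV_norm_coord y i)).
by apply: hM => //; rewrite ltr_pwDr// ler_norm.
Qed.

Lemma convex_body_measurable P : convex_body P -> measurable P.
Proof.
move=> [cP _ _]; rewrite -(setCK P); apply: measurableC.
apply: open_measurable_rV; rewrite openC; exact: compact_closed.
Qed.

Lemma convex_body_interior P : convex_body P ->
  exists2 r, 0 < r & forall y, (forall i, `|y ord0 i| < r) -> P y.
Proof.
move=> [_ _ /nbhs_ballP[r /= r0 rP]]; exists r => // y hy.
by apply: rP; apply/rV_ballE => // i; rewrite mxE sub0r normrN.
Qed.

Lemma convex_body_lty P : convex_body P -> (leb P < +oo)%E.
Proof.
move=> Pb; have [M M0 hM] := convex_body_bounded Pb.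
apply: (@le_lt_trans _ _ (leb (box (const_mx (- M)) (const_mx M)))).
  apply: le_measure; rewrite ?inE; [exact: convex_body_measurable|exact: measurable_box|].
  by move=> y Py i; rewrite !mxE -ler_norml; exact: hM.
rewrite lebesgue_box ?ltry// => i; rewrite !mxE.
by rewrite (le_trans (ltW _) (ltW M0))// oppr_lt0.
Qed.

Lemma volumeE P : convex_body P -> leb P = (volume P)%:E.
Proof.
by move=> Pb; rewrite fineK// ge0_fin_numE//; exact: convex_body_lty.
Qed.

Lemma volume_gt0 P : convex_body P -> 0 < volume P.
Proof.
move=> Pb; rewrite -lte_fin -volumeE//.
have [_ _ iP] := Pb.
apply: (lt_le_trans (lebesgue_open_gt0 (@open_interior _ P) iP)).
apply: le_measure; rewrite ?inE.
- by apply: open_measurable_rV; exact: open_interior.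
- exact: convex_body_measurable.
- exact: interior_subset.
Qed.

End convex_bodies.

(** * Bounded measurable functions on a convex body and its barycenter *)

Section bounded_measurable.
Context {R : realType} {n : nat}.
Implicit Types (P : set 'rV[R]_n) (x y z a : 'rV[R]_n) (f g h l : 'rV[R]_n -> R).
Local Notation leb := (@lebesgue_rV R n).

Definition bounded_measurable P f :=
  measurable_fun P f /\ exists M, forall y, P y -> `|f y| <= M.

Lemma bounded_measurable_cst P (c : R) : bounded_measurable P (fun=> c).
Proof. by split => //; exists `|c|. Qed.

Lemma bounded_measurableD P f g : bounded_measurable P f ->
  bounded_measurable P g -> bounded_measurable P (fun y => f y + g y).
Proof.
move=> [mf [M hM]] [mg [N hN]]; split; first exact: measurable_funD.
by exists (M + N) => y Py; rewrite (le_trans (ler_normD _ _))// lerD ?hM ?hN.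
Qed.

Lemma bounded_measurableM P f g : bounded_measurable P f ->
  bounded_measurable P g -> bounded_measurable P (fun y => f y * g y).
Proof.
move=> [mf [M hM]] [mg [N hN]]; split; first exact: measurable_funM.
by exists (M * N) => y Py; rewrite normrM ler_pM ?hM ?hN.
Qed.

Lemma bounded_measurableB P f g : bounded_measurable P f ->
  bounded_measurable P g -> bounded_measurable P (fun y => f y - g y).
Proof.
move=> [mf [M hM]] [mg [N hN]]; split; first exact: measurable_funB.
by exists (M + N) => y Py; rewrite (le_trans (ler_normB _ _))// lerD ?hM ?hN.
Qed.

Lemma bounded_measurable_max P f g : bounded_measurable P f ->
  bounded_measurable P g -> bounded_measurable P (fun y => Num.max (f y) (g y)).
Proof.
move=> [mf [M hM]] [mg [N hN]]; split; first exact: measurable_maxr.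
exists (Num.max M N) => y Py; rewrite /Num.max; case: ifPn => _.
  by rewrite (le_trans (hN _ Py))// le_max lexx orbT.
by rewrite (le_trans (hM _ Py))// le_max lexx.
Qed.

Lemma bounded_measurable_eq P f g : (forall y, P y -> f y = g y) ->
  bounded_measurable P g -> bounded_measurable P f.
Proof.
move=> fg [mg [M hM]]; split.
  by apply: eq_measurable_fun mg => y; rewrite inE => /fg.
by exists M => y Py; rewrite fg// hM.
Qed.

Lemma bounded_measurable_affine P l : convex_body P -> is_affine l ->
  bounded_measurable P l.
Proof.
move=> Pb [a [c lE]].
apply: (@bounded_measurable_eq _ _ (fun y => dot a y + c)) => [y _//|].
apply: bounded_measurableD; last exact: bounded_measurable_cst.
split; first exact: measurable_dot.
have [M M0 hM] := convex_body_bounded Pb.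
exists (\sum_i `|a ord0 i| * M) => y Py.
rewrite (le_trans (ler_norm_sum _ _ _))// ler_sum// => i _.
by rewrite normrM ler_wpM2l// hM.
Qed.

Lemma bounded_measurable_integrable P f : convex_body P ->
  bounded_measurable P f -> leb.-integrable P (EFin \o f).
Proof.
move=> Pb [mf [M hM]]; apply: measurable_bounded_integrable => //.
- exact: convex_body_measurable.
- exact: convex_body_lty.
- exists M; split; first exact: num_real.
  by move=> N MN y /= Py; rewrite (le_trans (hM _ Py))// ltW.
Qed.

Lemma integral_EFin P f : convex_body P -> bounded_measurable P f ->
  (\int[leb]_(y in P) (f y)%:E = (\int[leb]_(y in P) f y)%:E)%E.
Proof.
move=> Pb bf; rewrite fineK//; apply: integrable_fin_num.
  exact: convex_body_measurable.
exact: bounded_measurable_integrable.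
Qed.

Section body.
Context (P : set 'rV[R]_n) (Pb : convex_body P).

Lemma bm_RintegralD f g : bounded_measurable P f -> bounded_measurable P g ->
  \int[leb]_(y in P) (f y + g y) =
  \int[leb]_(y in P) f y + \int[leb]_(y in P) g y.
Proof.
move=> bf bg; rewrite RintegralD//.
- exact: convex_body_measurable.
- exact: bounded_measurable_integrable.
- exact: bounded_measurable_integrable.
Qed.

Lemma bm_RintegralB f g : bounded_measurable P f -> bounded_measurable P g ->
  \int[leb]_(y in P) (f y - g y) =
  \int[leb]_(y in P) f y - \int[leb]_(y in P) g y.
Proof.
move=> bf bg; rewrite RintegralB//.
- exact: convex_body_measurable.
- exact: bounded_measurable_integrable.
- exact: bounded_measurable_integrable.
Qed.

Lemma bm_RintegralZl (c : R) f : bounded_measurable P f ->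
  \int[leb]_(y in P) (c * f y) = c * \int[leb]_(y in P) f y.
Proof.
move=> bf; rewrite RintegralZl//.
- exact: convex_body_measurable.
- exact: bounded_measurable_integrable.
Qed.

Lemma bm_le_Rintegral f g : bounded_measurable P f -> bounded_measurable P g ->
  (forall y, P y -> f y <= g y) ->
  \int[leb]_(y in P) f y <= \int[leb]_(y in P) g y.
Proof.
move=> bf bg fg; apply: le_Rintegral => //.
- exact: convex_body_measurable.
- exact: bounded_measurable_integrable.
- exact: bounded_measurable_integrable.
Qed.

Lemma Rintegral_volume (c : R) : \int[leb]_(y in P) c = c * volume P.
Proof. by rewrite Rintegral_cst//; exact: convex_body_measurable. Qed.

Definition barycenter : 'rV[R]_n :=
  \row_i ((volume P)^-1 * \int[leb]_(y in P) y ord0 i).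

Lemma bounded_measurable_coord i : bounded_measurable P (fun y => y ord0 i).
Proof.
split; first by apply: measurable_funTS; exact: measurable_rV_coord.
by have [M _ hM] := convex_body_bounded Pb; exists M => y /hM.
Qed.

Lemma Rintegral_affine l : is_affine l ->
  \int[leb]_(y in P) l y = volume P * l barycenter.
Proof.
move=> [a [c lE]]; have bc i := bounded_measurable_coord i.
have bs (s : seq 'I_n) : bounded_measurable P (fun y => \sum_(i <- s) a ord0 i * y ord0 i) /\
    \int[leb]_(y in P) (\sum_(i <- s) a ord0 i * y ord0 i) =
    volume P * \sum_(i <- s) a ord0 i * barycenter ord0 i.
  elim: s => [|i s [IHb IHi]].
    split; last first.
      under eq_Rintegral do rewrite big_nil.
      by rewrite Rintegral_volume big_nil mul0r mulr0.
    by under eq_fun do rewrite big_nil; exact: bounded_measurable_cst.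
  have bi : bounded_measurable P (fun y => a ord0 i * y ord0 i).
    by apply: bounded_measurableM => //; exact: bounded_measurable_cst.
  split; first by under eq_fun do rewrite big_cons; exact: bounded_measurableD.
  under eq_Rintegral do rewrite big_cons.
  rewrite bm_RintegralD// IHi big_cons mulrDr bm_RintegralZl// mxE; congr (_ + _).
  by rewrite mulrCA mulVKf// gt_eqF// volume_gt0.
under eq_Rintegral do rewrite lE.
have [bd di] := bs (index_enum 'I_n).
rewrite bm_RintegralD ?Rintegral_volume//; last exact: bounded_measurable_cst.
by rewrite [X in X + _]di lE mulrDr (mulrC c).
Qed.

(** If [q] is the point of [P] nearest to the barycenter [b], the affine function
    [<q - b, . - q>] is nonnegative on [P], while its mean, its value at [b], is
    [- |q - b|^2]; so [b = q]. *)
Lemma barycenter_in : P barycenter.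
Proof.
have [cP vP iP] := Pb; set b := barycenter.
have P0 : P !=set0 by exists 0; exact: interior_subset iP.
have cd : continuous (fun x => dot (x - b) (x - b)).
  apply: continuous_big => [|i _]; first exact: add_continuous.
  have h : continuous (fun x : 'rV[R]_n => (x - b) ord0 i).
    have -> : (fun x : 'rV[R]_n => (x - b) ord0 i) = (fun x => x ord0 i - b ord0 i).
      by apply/funext => x; rewrite !mxE.
    move=> x; apply: (@cvgB _ R^o _ _ (nbhs_filter x)); first exact: coord_continuous.
    exact: cvg_cst.
  by move=> x; apply: continuousM; exact: h.
have [q] := EVT_min_rV P0 cP (continuous_subspaceT cd).
rewrite inE => Pq qmin.
have h0 x : P x -> 0 <= dot (q - b) (x - q).
  move=> Px; rewrite leNgt; apply/negP; set A := dot _ _ => A0.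
  set B := dot (x - q) (x - q).
  have B0 : 0 <= B by exact: dot_ge0.
  (* For this step [t] along the segment from [q] to [x], the first-order decrease
     [2 t A] of the squared distance outweighs its second-order increase [t^2 B]. *)
  pose t := Num.min 1 (- A / (B + 1)).
  have t0 : 0 < t by rewrite lt_min ltr01 divr_gt0 ?oppr_gt0// ltr_wpDl.
  have t1 : t <= 1 by rewrite ge_min lexx.
  have tB : t * (B + 1) <= - A.
    by rewrite -ler_pdivlMr ?ltr_wpDl// /t ge_min lexx orbT.
  have := qmin (q + t *: (x - q)).
  rewrite inE => /(_ (vP _ _ _ Pq Px _)); rewrite (ltW t0) t1 => /(_ isT).
  have -> : dot (q + t *: (x - q) - b) (q + t *: (x - q) - b) =
      dot (q - b) (q - b) + t * (2 * A + t * B).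
    rewrite addrAC /A /B; move: (q - b) (x - q) => w v.
    by rewrite dotDl !dotDr !(dotZl, dotZr) (dotC v w); ring.
  rewrite lerDl pmulr_rge0// => h.
  lra.
have hl : is_affine (fun x => dot (q - b) (x - q)).
  by exists (q - b), (- dot (q - b) q) => x; rewrite dotDr dotNr.
have : 0 <= volume P * dot (q - b) (b - q).
  by rewrite -(Rintegral_affine hl); exact: Rintegral_ge0.
rewrite pmulr_rge0 ?volume_gt0// -[b - q]opprB dotNr oppr_ge0 => qb.
have /dot_eq0/subr0_eq <- // : dot (q - b) (q - b) = 0.
by apply/eqP; rewrite eq_le qb dot_ge0.
Qed.

(** Jensen's inequality. Since [l] ranges over all affine functions, equality
    holds for convex [f]. *)
Lemma JT_ge (F : 'rV[R]_n -> \bar R) f : bounded_measurable P f ->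
  (forall y, P y -> F y = (f y)%:E) ->
  (((volume P)^-1 * \int[leb]_(y in P) f y - f barycenter)%:E <= JT P F)%E.
Proof.
move=> bf Ff; apply: le_ereal_inf_tmp => _ [l /= lA <-].
have bl := bounded_measurable_affine Pb lA.
rewrite (eq_integral (fun y => (f y - l y)%:E)); last first.
  by move=> y; rewrite inE => Py; rewrite Ff.
rewrite integral_EFin//; last exact: bounded_measurableB.
rewrite bm_RintegralB// (Rintegral_affine lA) -EFinM mulrBr.
rewrite mulKf ?gt_eqF ?volume_gt0//.
set I := _ * _.
rewrite (_ : I - _ = (I - l barycenter) - (f barycenter - l barycenter)); last by ring.
rewrite EFinB leeB//; apply: ereal_inf_lbound.
by exists barycenter; [exact: barycenter_in|rewrite Ff//; exact: barycenter_in].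
Qed.

Lemma JT_le (F : 'rV[R]_n -> \bar R) l : is_affine l ->
  (forall y, P y -> (0 <= F y - (l y)%:E)%E) ->
  (JT P F <= (volume P)^-1%:E * \int[leb]_(y in P) (F y - (l y)%:E))%E.
Proof.
move=> lA Fl; apply: ge_ereal_inf; eexists; first by exists l.
rewrite -[leRHS]sube0 leeB//; apply: le_ereal_inf_tmp => _ [y Py <-].
exact: Fl.
Qed.

End body.
End bounded_measurable.

(** * Affine functions against the Ricci density *)

Section ricci.
Context {R : realType} {n : nat}.
Context (P : set 'rV[R]_n) (Pb : convex_body P).
Implicit Types (x y z a : 'rV[R]_n) (f g h u : 'rV[R]_n -> R).
Local Notation leb := (@lebesgue_rV R n).

Lemma convex_body0 : P 0.
Proof. by have [_ _ iP] := Pb; exact: interior_subset iP. Qed.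

Lemma affine_segment h x y (t : R) : is_affine h ->
  h (x + t *: (y - x)) = h x + t * (h y - h x).
Proof. by move=> [a [c hE]]; rewrite !hE dotDr dotZr dotDr dotNr; ring. Qed.

Lemma Rintegral_gt0_open f (U : set 'rV[R]_n) q (c : R) :
  bounded_measurable P f -> (forall y, P y -> 0 <= f y) ->
  open U -> U q -> U `<=` P -> 0 < c -> (forall y, U y -> c <= f y) ->
  0 < \int[leb]_(y in P) f y.
Proof.
move=> bf f0 oU Uq UP c0 cf; rewrite -lte_fin -integral_EFin//.
have mU := open_measurable_rV oU.
have [mf _] := bf.
apply: (@lt_le_trans _ _ (\int[leb]_(y in U) c%:E)%E).
  by rewrite integral_cst// mule_gt0// (lebesgue_open_gt0 oU Uq).
apply: (@le_trans _ _ (\int[leb]_(y in U) (f y)%:E)%E).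
  apply: ge0_le_integral => //.
  - by move=> y _; rewrite lee_fin ltW.
  - apply/measurable_EFinP; apply: measurable_funS mf => //.
    exact: convex_body_measurable.
apply: ge0_subset_integral => //.
- exact: convex_body_measurable.
- exact/measurable_EFinP.
Qed.

Lemma open_affine_gt h (s : R) : is_affine h -> open [set y | s < h y].
Proof.
move=> [a [c hE]]; rewrite (_ : mkset _ = dot a @^-1` [set t | s - c < t]).
  by move/continuousP : (@dot_continuous R n a); apply; exact: open_gt.
by apply/seteqP; split => z /=; rewrite hE ltrBlDr.
Qed.

(** An affine [u] positive at some point of [P] is positive at an interior point,
    found on the segment from that point to the interior point [0]. *)
Lemma Rintegral_pos_part_gt0 u p : is_affine u -> u 0 <= 0 -> P p -> 0 < u p ->
  0 < \int[leb]_(y in P) Num.max 0 (u y).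
Proof.
move=> uA u0 Pp up.
have bu : bounded_measurable P (fun y => Num.max 0 (u y)).
  apply: bounded_measurable_max; first exact: bounded_measurable_cst.
  exact: bounded_measurable_affine.
have [_ vP _] := Pb.
have [r r0 hr] := convex_body_interior Pb.
pose t := u p / (2 * (u p - u 0)).
have d0 : 0 < u p - u 0 by lra.
have t0 : 0 < t by rewrite divr_gt0// mulr_gt0.
have t1 : t <= 1 by rewrite ler_pdivrMr ?mulr_gt0//; lra.
have tE : t * (u 0 - u p) = - (u p / 2).
  by rewrite /t; field; rewrite gt_eqF//=; lra.
pose q := p + t *: (0 - p).
have uq : u q = u p / 2 by rewrite affine_segment// tE; field.
pose U := P^° `&` [set y | u p / 4 < u y].
apply: (@Rintegral_gt0_open _ U q (u p / 4)) => //.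
- by move=> y _; rewrite le_max lexx.
- by apply: openI; [exact: open_interior|exact: open_affine_gt].
- split; last by rewrite /= uq; lra.
  apply/nbhs_ballP; exists (t * r) => /=; first by rewrite mulr_gt0.
  move=> y /rV_ballE h; pose z := t^-1 *: (y - q).
  rewrite (_ : y = p + t *: (z - p)); last first.
    rewrite scalerBr scalerA divff ?gt_eqF// scale1r /q sub0r scalerN.
    by rewrite addrC -addrA addrC; rewrite opprB !addrA; apply/rowP => i; rewrite !mxE; ring.
  apply: vP => //; last by rewrite (ltW t0).
  apply: hr => i; rewrite !mxE normrM gtr0_norm ?invr_gt0//.
  rewrite ltr_pdivrMl//; have := h (mulr_gt0 t0 r0) i.
  by rewrite !mxE distrC.
- by move=> y [/interior_subset].
- by rewrite divr_gt0.
- by move=> y [_ /= /ltW h]; rewrite le_max h orbT.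
Qed.

(** The slope and the constant term are approximated within [e / (n M + 1)], where
    [M] bounds the coordinates on [P]. *)
Lemma rational_affine_approx h (e : R) : is_affine h -> 0 < e ->
  exists (a : 'rV[rat]_n) (c : rat), forall y, P y ->
    `|dot (map_mx ratr a) y + ratr c - h y| <= e.
Proof.
move=> [a [c hE]] e0; have [M M0 hM] := convex_body_bounded Pb.
pose d := e / (n%:R * M + 1).
have k0 : 0 < n%:R * M + 1 by rewrite ltr_wpDl// mulr_ge0// ltW.
have d0 : 0 < d by rewrite divr_gt0.
have approx (s : R) : exists q : rat, `|ratr q - s| <= d.
  have [|q] := @rat_in_itvoo R s (s + d); first by rewrite ltrDl.
  rewrite in_itv/= => /andP[q1 q2]; exists q.
  by rewrite ler_norml; apply/andP; split; lra.
have [q qP] := choice (fun i => approx (a ord0 i)).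
have [p pP] := approx c.
exists (\row_i q i), p => y Py.
rewrite hE (_ : _ - _ = dot (map_mx ratr (\row_i q i) - a) y + (ratr p - c)); last first.
  by rewrite dotDl dotNl; ring.
rewrite (le_trans (ler_normD _ _))//.
rewrite (_ : e = n%:R * M * d + d); last by rewrite /d; field; rewrite gt_eqF.
apply: lerD => //; rewrite (le_trans (ler_norm_sum _ _ _))//.
rewrite (_ : n%:R * M * d = \sum_(i < n) d * M); last first.
  by rewrite sumr_const card_ord -[RHS]mulr_natl; ring.
apply: ler_sum => i _; rewrite normrM ler_pM// ?hM// !mxE.
exact: qP.
Qed.

Context (l : 'rV[R]_n -> R) (l_ricci : is_ricci_affine P l).
Local Notation m := (inf (l @` P)).
Local Notation b := (barycenter P).

Lemma ricci_bounded_measurable : bounded_measurable P l.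
Proof. by apply: bounded_measurable_affine => //; case: l_ricci. Qed.

Lemma ricciE h : is_affine h -> \int[leb]_(y in P) (h y * l y) = h 0.
Proof.
move=> hA; have := l_ricci.2 h hA; rewrite integral_EFin//; last first.
  apply: bounded_measurableM; last exact: ricci_bounded_measurable.
  exact: bounded_measurable_affine.
by rewrite -EFinD => -[] /eqP; rewrite addrC subr_eq0 => /eqP.
Qed.

Lemma ricci_has_inf : has_inf (l @` P).
Proof.
have [_ [M hM]] := ricci_bounded_measurable; split.
  by exists (l 0), 0 => //; exact: convex_body0.
exists (- M) => _ [y Py <-]; have := hM _ Py.
by rewrite ler_norml => /andP[].
Qed.

Lemma inf_le_ricci y : P y -> m <= l y.
Proof. by move=> Py; apply: ge_inf; [case: ricci_has_inf|exists y]. Qed.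

Lemma inf_approx (e : R) : 0 < e -> exists2 p, P p & l p < m + e.
Proof.
by move=> e0; have [_ [p Pp <-] h] := inf_adherent e0 ricci_has_inf; exists p.
Qed.

(** The functions [max 0 u] test both notions of stability. When [l] is not
    constant, it exceeds its infimum strictly at the interior points [0] and [b],
    and [u] is a rational approximation of [m + e/2 - l]. When [l] is constant, the
    third condition holds for every [u], and the barycenter is [0], because the
    coordinate functions have mean [0] for the constant density [l]. *)
Lemma test_function (e : R) : (0 < n)%N -> 0 < e ->
  exists (a : 'rV[rat]_n) (c : rat),
    let u y := dot (map_mx ratr a) y + ratr c in
    [/\ u 0 <= 0, u b <= 0, forall y, P y -> 0 < u y -> l y <= m + e &
        0 < \int[leb]_(y in P) Num.max 0 (u y)].
Proof.
move=> n0 e0; have [[a [c lE]] _] := l_ricci.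
have lA : is_affine l by case: l_ricci.
have [r r0 hr] := convex_body_interior Pb.
have [a0|aN0] := eqVneq a 0.
  have lc y : l y = c by rewrite lE a0 dot0l add0r.
  pose i0 := Ordinal n0; pose d : 'rV[rat]_n := delta_mx ord0 i0.
  have dE y : dot (map_mx ratr d) y = y ord0 i0.
    rewrite /dot (bigD1 i0)//= !mxE !eqxx rmorph1 mul1r big1 ?addr0// => j ji.
    by rewrite !mxE (negPf ji) andbF rmorph0 mul0r.
  have uE : (fun y => dot (map_mx ratr d) y + ratr 0) = fun y => y ord0 i0.
    by apply/funext => y; rewrite dE rmorph0 addr0.
  have uA : is_affine (fun y : 'rV[R]_n => y ord0 i0).
    by rewrite -uE; exact: affine_dot.
  exists d, 0 => /=.
  have uy y : dot (map_mx ratr d) y + ratr 0 = y ord0 i0.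
    by rewrite -[RHS]dE rmorph0 addr0.
  have c1 : c * volume P = 1.
    rewrite -Rintegral_volume//; have := ricciE (affine_dot 0 1).
    rewrite dot0l add0r => h; rewrite -[RHS]h; apply: eq_Rintegral => y _.
    by rewrite lc dot0l add0r mul1r.
  have b0 : b ord0 i0 = 0.
    have := ricciE uA; rewrite mxE.
    under eq_Rintegral do rewrite lc mulrC.
    rewrite bm_RintegralZl//; last exact: bounded_measurable_coord.
    by rewrite (Rintegral_affine Pb uA) mulrA c1 mul1r.
  split.
  - by rewrite uy mxE.
  - by rewrite uy b0.
  - by move=> y Py _; have [p _] := inf_approx e0; rewrite !lc => /ltW.
  - under eq_Rintegral do rewrite uy.
    pose p : 'rV[R]_n := (r / 2) *: map_mx ratr d.
    have pE i : p ord0 i = r / 2 * (i == i0)%:R.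
      by rewrite !mxE eqxx/= ratr_nat.
    apply: (@Rintegral_pos_part_gt0 _ p) => //.
    + by rewrite mxE.
    + apply: hr => i; rewrite pE; case: eqP => _; rewrite ?mulr1 ?mulr0 ?normr0//.
      by rewrite gtr0_norm ?divr_gt0//; lra.
    + by rewrite pE eqxx mulr1 divr_gt0.
have l0m : m < l 0.
  have [s s0 hs] : exists2 s, 0 < s & P (- (s *: a)).
    have [k k0 hk] : exists2 k, 0 < k & forall i, `|a ord0 i| < k.
      exists (`|a| + 1); first by rewrite ltr_wpDl.
      by move=> i; rewrite (le_lt_trans (rV_norm_coord a i))// ltrDl.
    exists (r / k); first by rewrite divr_gt0.
    apply: hr => i; rewrite !mxE normrN normrM gtr0_norm ?divr_gt0//.
    by rewrite mulrAC ltr_pdivrMr// ltr_pM2l.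
  apply: (le_lt_trans (inf_le_ricci hs)); rewrite !lE dotNr dotZr dot0r.
  rewrite ltrD2r oppr_lt0 mulr_gt0// lt_neqAle dot_ge0 andbT eq_sym.
  by apply: contra aN0 => /eqP/dot_eq0 ->.
have bl := ricci_bounded_measurable.
have lbm : m < l b.
  have : 0 < \int[leb]_(y in P) (l y - m).
    apply: (@Rintegral_gt0_open _ (P^° `&` [set y | (l 0 + m) / 2 < l y]) 0 ((l 0 - m) / 2)).
    - by apply: bounded_measurableB => //; exact: bounded_measurable_cst.
    - by move=> y Py; rewrite subr_ge0; exact: inf_le_ricci.
    - by apply: openI; [exact: open_interior|exact: open_affine_gt].
    - by split; [case: Pb|rewrite /=; lra].
    - by move=> y [/interior_subset].
    - by rewrite divr_gt0// subr_gt0.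
    - by move=> y [_ /=]; lra.
  rewrite bm_RintegralB//; last exact: bounded_measurable_cst.
  rewrite (Rintegral_affine Pb lA) Rintegral_volume// mulrC -mulrBl.
  by rewrite pmulr_lgt0 ?volume_gt0// subr_gt0.
(* Both [0] and [b] must lie where [l >= m + e'], well outside of [u > 0]. *)
pose e' := Num.min e (Num.min (l 0 - m) (l b - m)).
have e'0 : 0 < e' by rewrite !lt_min e0 !subr_gt0 l0m.
have e'e : e' <= e by rewrite ge_min lexx.
have e'l0 : e' <= l 0 - m by rewrite !ge_min lexx orbT.
have e'lb : e' <= l b - m by rewrite !ge_min lexx !orbT.
have vA : is_affine (fun y => m + e' / 2 - l y).
  by exists (- a), (m + e' / 2 - c) => y; rewrite lE dotNl; ring.
have [a' [c' hu]] := rational_affine_approx vA (divr_gt0 e'0 (ltr0n _ 4)).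
exists a', c'; move: hu; set u := fun y => dot _ y + _ => /= hu.
have {}hu y : P y -> m + e' / 2 - l y - e' / 4 <= u y <= m + e' / 2 - l y + e' / 4.
  move=> /hu; rewrite ler_norml => /andP[h1 h2]; apply/andP; split; rewrite /u; lra.
have P0 := convex_body0; have bP := barycenter_in Pb.
split.
- by have /andP[_] := hu _ P0; rewrite -/(u 0); lra.
- by have /andP[_] := hu _ bP; rewrite -/(u b); lra.
- by move=> y /hu /andP[_]; rewrite -/(u y); lra.
- have [p Pp lp] := inf_approx (divr_gt0 e'0 (ltr0n _ 4)).
  apply: (@Rintegral_pos_part_gt0 u p) => //.
  + exact: affine_dot.
  + by have /andP[_] := hu _ P0; lra.
  + by have /andP[+ _] := hu _ Pp; lra.
Qed.

End ricci.

(** * Stability *)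

Section stability.
Context {R : realType} {n : nat}.
Context (P : set 'rV[R]_n) (Pb : convex_body P).
Context (l : 'rV[R]_n -> R) (l_ricci : is_ricci_affine P l).
Implicit Types (x y z a : 'rV[R]_n) (f g h u : 'rV[R]_n -> R).
Local Notation leb := (@lebesgue_rV R n).
Local Notation m := (inf (l @` P)).
Local Notation b := (barycenter P).

(** The affine support at [0] is a piece attaining the maximum there. *)
Lemma rational_PLP f : rational_PL P f ->
  bounded_measurable P f /\
  exists2 l0 : 'rV[R]_n -> R, is_affine l0 &
    f 0 = l0 0 /\ forall y, P y -> l0 y <= f y.
Proof.
move=> [k [a [c]]]; set g := fun i y => _ => /= fE.
have gA i : is_affine (g i) by exact: affine_dot.
split.
  apply: (bounded_measurable_eq fE).
  elim: (index_enum _) => [|i s IH].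
    by under eq_fun do rewrite big_nil; exact: bounded_measurable_affine.
  under eq_fun do rewrite big_cons.
  by apply: bounded_measurable_max => //; exact: bounded_measurable_affine.
have P0 := convex_body0 Pb.
have [i fi] : exists i, f 0 = g i 0.
  rewrite fE//; elim/big_ind: _; first by exists ord0.
    by move=> s t [i ->] [j ->]; rewrite /Num.max; case: ifP => _; [exists j|exists i].
  by move=> i _; exists i.
exists (g i) => //; split => // y Py; rewrite fE//.
exact: (le_bigmax (g ord0 y) (fun i => g i y) i).
Qed.

(** Adding an affine function changes neither functional, so [f] may be normalised
    by [f >= 0 = f 0]; then [D^NA f] is the integral of [f l], and the mean of [f]
    bounds [J^T f] from above. *)
Lemma D_stable_le_inf (delta : R) : 0 <= delta -> delta <= volume P * m ->
  D_stable_with P l delta.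
Proof.
move=> d0 dm f /rational_PLP[bf [l0 l0A [fl0 l0f]]].
have V0 := volume_gt0 Pb.
have bl := ricci_bounded_measurable Pb l_ricci.
have bl0 := bounded_measurable_affine Pb l0A.
have bh := bounded_measurableB bf bl0.
have JTle : (JT P (EFin \o f) <=
    ((volume P)^-1 * \int[leb]_(y in P) (f y - l0 y))%:E)%E.
  rewrite EFinM -integral_EFin//; apply: JT_le => // y Py.
  by rewrite lee_fin subr_ge0 l0f.
apply: (le_trans (lee_wpmul2l _ JTle)); first by rewrite lee_fin.
rewrite /dingNA integral_EFin//; last exact: bounded_measurableM.
rewrite -EFinM -EFinD lee_fin.
have -> : \int[leb]_(y in P) (f y * l y) =
    \int[leb]_(y in P) ((f y - l0 y) * l y) + l0 0.
  rewrite -(ricciE Pb l_ricci l0A) -bm_RintegralD//; last 2 first.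
  - exact: bounded_measurableM.
  - exact: bounded_measurableM.
  by apply: eq_Rintegral => y _; ring.
rewrite fl0 addrCA addNr addr0.
apply: (@le_trans _ _ (\int[leb]_(y in P) (m * (f y - l0 y)))); last first.
  apply: bm_le_Rintegral => //.
  - by apply: bounded_measurableM => //; exact: bounded_measurable_cst.
  - exact: bounded_measurableM.
  - move=> y Py; rewrite mulrC ler_wpM2l ?subr_ge0 ?l0f//.
    exact: inf_le_ricci.
rewrite bm_RintegralZl// mulrA ler_wpM2r//.
  by apply: Rintegral_ge0 => y Py; rewrite subr_ge0 l0f.
by rewrite ler_pdivrMr// mulrC.
Qed.

(** On the test functions of [test_function] the right-hand side is at most [m + e]
    times the integral of [f]; divide by that integral and let [e] tend to [0]. *)
Lemma inf_ge_of_test (delta : R) : (0 < n)%N ->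
  (forall (a : 'rV[rat]_n) (c : rat),
    let f y := Num.max 0 (dot (map_mx ratr a) y + ratr c) in
    f 0 = 0 -> f b = 0 ->
    delta * ((volume P)^-1 * \int[leb]_(y in P) f y) <=
    \int[leb]_(y in P) (f y * l y)) ->
  delta <= volume P * m.
Proof.
move=> n0 dtest; have V0 := volume_gt0 Pb.
rewrite mulrC -ler_pdivrMr//; apply/ler_addgt0Pr => e e0.
have [a [c /=]] := test_function Pb l_ricci n0 e0.
pose u y := dot (map_mx ratr a) y + ratr c.
rewrite -/(u 0) -/(u b) => -[u0 ub ul uI].
have uA : is_affine u by exact: affine_dot.
have bl := ricci_bounded_measurable Pb l_ricci.
have bf : bounded_measurable P (fun y => Num.max 0 (u y)).
  apply: bounded_measurable_max; first exact: bounded_measurable_cst.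
  exact: bounded_measurable_affine.
have := dtest a c; rewrite /= -/(u 0) -/(u b) (max_l u0) (max_l ub).
move=> /(_ erefl erefl) /le_trans.
move=> /(_ ((m + e) * \int[leb]_(y in P) Num.max 0 (u y))).
rewrite mulrA ler_pM2r//; apply.
rewrite -bm_RintegralZl//; apply: bm_le_Rintegral => //.
- exact: bounded_measurableM.
- by apply: bounded_measurableM => //; exact: bounded_measurable_cst.
- move=> y Py; have [uy|uy] := leP (u y) 0.
    by rewrite mul0r mulr0.
  by rewrite mulrC ler_wpM2r ?ul// ltW.
Qed.

Lemma D_stable_inf_ge (delta : R) : (0 < n)%N -> 0 <= delta ->
  D_stable_with P l delta -> delta <= volume P * m.
Proof.
move=> n0 d0 st; apply: inf_ge_of_test => // a c f f0 fb.
have bl := ricci_bounded_measurable Pb l_ricci.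
have bf : bounded_measurable P f.
  apply: bounded_measurable_max; first exact: bounded_measurable_cst.
  by apply: bounded_measurable_affine => //; exact: affine_dot.
have PLf : rational_PL P f.
  exists 1%N, (fun i => if i == ord0 then 0 else a), (fun i => if i == ord0 then 0 else c).
  move=> /= y _; rewrite !big_ord_recl big_ord0 /= rmorph0 addr0.
  rewrite (_ : map_mx _ 0 = 0); last by apply/rowP => i; rewrite !mxE rmorph0.
  by rewrite dot0l (maxC _ 0) maxA maxxx.
have := st f PLf; rewrite /dingNA f0 oppr0 add0e integral_EFin//; last first.
  exact: bounded_measurableM.
rewrite -lee_fin; apply: le_trans; rewrite EFinM; apply: lee_wpmul2l.
  by rewrite lee_fin.
by have := JT_ge Pb (F := EFin \o f) bf (fun y _ => erefl); rewrite fb subr0.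
Qed.

End stability.

(** * The coercivity threshold is at most [V_P inf l] *)

Section conjugates.
Context {R : realType} {n : nat}.
Context (P : set 'rV[R]_n) (Pb : convex_body P).
Implicit Types (x y z a : 'rV[R]_n) (f g h u : 'rV[R]_n -> R).
Local Notation leb := (@lebesgue_rV R n).

(** The Legendre transform of [f] extended by [+oo] outside [P]. *)
Definition conjugate f x : R := sup [set dot x y - f y | y in P].

Section conjugate.
Context (f : 'rV[R]_n -> R) (bf : bounded_measurable P f).

Lemma conjugate_has_sup x : has_sup [set dot x y - f y | y in P].
Proof.
split; first by exists (dot x 0 - f 0), 0 => //; exact: convex_body0.
have [_ [M hM]] : bounded_measurable P (fun y => dot x y - f y).
  apply: bounded_measurableB => //; apply: bounded_measurable_affine => //.
  by exists x, 0 => y; rewrite addr0.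
by exists M => _ [y Py <-]; rewrite (le_trans (ler_norm _))// hM.
Qed.

Lemma conjugate_ge x y : P y -> dot x y - f y <= conjugate f x.
Proof.
by move=> Py; apply: ub_le_sup; [case: (conjugate_has_sup x)|exists y].
Qed.

Lemma conjugate_le x (c : R) : (forall y, P y -> dot x y - f y <= c) ->
  conjugate f x <= c.
Proof.
move=> h; apply: ge_sup; first by case: (conjugate_has_sup x).
by move=> _ [y Py <-]; exact: h.
Qed.

Lemma convex_conjugate :
  convex_function (E := 'rV[R]_n) [set: 'rV[R]_n] (conjugate f).
Proof.
move=> t x y _ _; rewrite convRE; apply: conjugate_le => z Pz.
rewrite (_ : _ - _ = t%:inum * (dot x z - f z) + (1 - t%:inum) * (dot y z - f z)).
  by rewrite lerD// ler_wpM2l ?conjugate_ge// subr_ge0.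
by rewrite dotDl !dotZl /unstable.onem; ring.
Qed.

(** An instance of the biconjugate theorem: at a point where the convex function
    has an affine support, the slope of the support attains the supremum. *)
Lemma legendre_conjugate y a (c : R) : P y ->
  (forall z, P z -> dot a z + c <= f z) -> f y = dot a y + c ->
  legendre (conjugate f) y = (f y)%:E.
Proof.
move=> Py af fy; apply/eqP; rewrite eq_le; apply/andP; split.
  apply: ge_ereal_sup => _ [x _ <-].
  by rewrite lee_fin lerBlDr -lerBlDl conjugate_ge.
apply: (le_trans _ (legendre_ge _ a y)); rewrite lee_fin fy lerD2l lerNr.
by apply: conjugate_le => z Pz; rewrite lerBlDr addrC -lerBlDr opprK af.
Qed.

End conjugate.

Lemma support_functionE : support_function P = conjugate (fun=> 0).
Proof.
apply/funext => x; rewrite /support_function /conjugate; congr (sup _).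
by apply/seteqP; split => _ [y Py <-]; exists y => //; rewrite subr0.
Qed.

Lemma conjugate_le_support f x : bounded_measurable P f ->
  (forall y, P y -> 0 <= f y) -> conjugate f x <= support_function P x.
Proof.
move=> bf f0; rewrite support_functionE; apply: (conjugate_le bf) => y Py.
rewrite (le_trans _ (conjugate_ge (bounded_measurable_cst P 0) x Py))//.
by rewrite lerD2l lerN2 f0.
Qed.

(** On the unit cube the support function is bounded, since [P] is; this bounds the
    integral below uniformly in [phi]. *)
Lemma integral_exp_support_gt0 : exists2 c : R, 0 < c &
  forall phi, (forall x, phi x <= support_function P x) ->
    (c%:E <= \int[leb]_x (expR (- phi x))%:E)%E.
Proof.
have [M M0 hM] := convex_body_bounded Pb.
pose B := box (const_mx 0) (const_mx 1 : 'rV[R]_n).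
have mB : measurable B by exact: measurable_box.
have BE : leb B = 1%E.
  rewrite lebesgue_box => [|i]; last by rewrite !mxE.
  by rewrite big1// => i _; rewrite !mxE subr0.
exists (expR (- (n%:R * M))); first exact: expR_gt0.
move=> phi hphi.
apply: (@le_trans _ _ (\int[leb]_x ((expR (- (n%:R * M)))%:E * (\1_B x)%:E))%E).
  rewrite ge0_integralZl//; last first.
    exact/measurable_EFinP.
  by rewrite integral_indic// setIT -[leLHS]mule1 -{1}BE.
apply: ge0_le_integralT => x; first by rewrite mule_ge0// lee_fin expR_ge0.
rewrite -EFinM lee_fin indicE; case: (boolP (x \in B)); last first.
  by rewrite mulr0 expR_ge0.
rewrite inE mulr1 ler_expR lerN2 => Bx; rewrite (le_trans (hphi x))//.
rewrite support_functionE; apply: conjugate_le; first exact: bounded_measurable_cst.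
move=> y Py; rewrite subr0 (_ : n%:R * M = \sum_(i < n) M); last first.
  by rewrite sumr_const card_ord mulr_natl.
apply: ler_sum => i _; have /andP[x0 x1] := Bx i; rewrite !mxE in x0 x1.
have /= yM := hM y Py i.
rewrite (le_trans (ler_norm _))// normrM -[leRHS]mul1r ler_pM// ger0_norm//.
Qed.

Context (l : 'rV[R]_n -> R) (l_ricci : is_ricci_affine P l).
Local Notation m := (inf (l @` P)).
Local Notation b := (barycenter P).

(** For [f = max 0 u], the potentials with Legendre transform [s f] lie below the
    support function, so only the second term of [D] depends on [s] without bound;
    letting [s] tend to infinity gives the stability inequality for [f]. *)
Lemma coercive_inf_ge (delta : R) : (0 < n)%N -> 0 <= delta ->
  coercive_with P l delta -> delta <= volume P * m.
Proof.
move=> n0 d0 [C hC]; apply: (inf_ge_of_test Pb l_ricci) => // a c f f0 fb.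
have V0 := volume_gt0 Pb.
have bl := ricci_bounded_measurable Pb l_ricci.
have uA : is_affine (fun y : 'rV[R]_n => dot (map_mx ratr a) y + ratr c).
  exact: affine_dot.
have bf : bounded_measurable P f.
  apply: bounded_measurable_max; first exact: bounded_measurable_cst.
  exact: bounded_measurable_affine.
have fge0 y : 0 <= f y by rewrite le_max lexx.
have [k k0 hk] := integral_exp_support_gt0.
set I := \int[leb]_(y in P) f y; set J := \int[leb]_(y in P) (f y * l y).
suff key (s : R) : 0 <= s -> s * (delta * ((volume P)^-1 * I) - J) <= C - ln k.
  rewrite leNgt; apply/negP; rewrite -subr_gt0; set A := _ - _ => A0.
  have /key : 0 <= (`|C - ln k| + 1) / A.
    by rewrite divr_ge0// ltW.
  rewrite divfK ?gt_eqF// => h.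
  by have := ler_norm (C - ln k); lra.
move=> s0; pose g y := s * f y.
have bg : bounded_measurable P g.
  by apply: bounded_measurableM => //; exact: bounded_measurable_cst.
have g0 y : P y -> 0 <= g y by move=> _; rewrite mulr_ge0.
have Lg y : P y -> legendre (conjugate g) y = (g y)%:E.
  move=> Py; have [uy|uy] := leP (dot (map_mx ratr a) y + ratr c) 0.
    apply: (@legendre_conjugate _ bg y 0 0) => //.
      by move=> z Pz; rewrite dot0l addr0; exact: g0.
    by rewrite dot0l addr0 /g /f max_l ?mulr0.
  apply: (@legendre_conjugate _ bg y (s *: map_mx ratr a) (s * ratr c)) => //.
    by move=> z Pz; rewrite dotZl -mulrDr ler_wpM2l// le_max lexx orbT.
  by rewrite dotZl -mulrDr /g /f max_r// ltW.
have E1g : E1 P (conjugate g).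
  split; first split.
  - exact: convex_conjugate.
  - by exists 0 => x; rewrite addr0; exact: conjugate_le_support.
  - rewrite (eq_integral (fun y => (g y)%:E)); last by move=> y; rewrite inE => /Lg.
    by rewrite integral_EFin// ltry.
have := hC _ E1g.
have JTg : ((s * ((volume P)^-1 * I))%:E <= JT P (legendre (conjugate g)))%E.
  have := JT_ge Pb bg Lg; rewrite {2}/g fb mulr0 subr0.
  by rewrite bm_RintegralZl// mulrCA.
have -> : ding P l (conjugate g) =
    (- lne (\int[leb]_x (expR (- conjugate g x))%:E) + (s * J)%:E)%E.
  congr (_ + _)%E; transitivity (\int[leb]_(y in P) (s * (f y * l y))%:E)%E.
    by apply: eq_integral => y; rewrite inE => Py; rewrite Lg// -EFinM mulrA.
  have bfl := bounded_measurableM bf bl.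
  rewrite integral_EFin ?bm_RintegralZl//.
  by apply: bounded_measurableM => //; exact: bounded_measurable_cst.
have lnk : (- lne (\int[leb]_x (expR (- conjugate g x))%:E) <= (- ln k)%:E)%E.
  rewrite EFinN leeN2 -lne_EFin// lee_lne//.
  - by apply: hk => x; exact: conjugate_le_support.
  - by rewrite in_itv /= leey lee_fin ltW.
  - rewrite in_itv /= leey andbT; apply: integral_ge0 => x _.
    by rewrite lee_fin expR_ge0.
move=> h; have : ((delta * (s * ((volume P)^-1 * I)))%:E - C%:E <= (- ln k)%:E + (s * J)%:E)%E.
  apply: (le_trans _ (le_trans h (leeD2r _ lnk))).
  by rewrite EFinM leeB// lee_wpmul2l// lee_fin.
by rewrite -EFinB -EFinD lee_fin; lra.
Qed.

End conjugates.

(** * Coercivity below the threshold [V_P inf l] *)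

Section coercivity.
Context {R : realType} {n : nat}.
Context (P : set 'rV[R]_n) (Pb : convex_body P).
Implicit Types (x y z a : 'rV[R]_n) (f g h u phi : 'rV[R]_n -> R).
Local Notation leb := (@lebesgue_rV R n).

Let mP : measurable P. Proof. exact: convex_body_measurable. Qed.

Definition l1norm z : R := \sum_(i < n) `|z ord0 i|.

(** The cube of side [r] in the orthant of [z] where [z_i y_i >= r |z_i|] lies in
    [P] and has volume [r^n], and on it the affine minorant is at least
    [r |z| - k]. *)
Lemma integral_orthant_ge (r : R) (G : 'rV[R]_n -> \bar R) z (k : R) :
  0 < r -> (forall y, (forall i, `|y ord0 i| <= 2 * r) -> P y) ->
  measurable_fun P G -> (forall y, P y -> (0 <= G y)%E) ->
  (forall y, P y -> ((dot z y - k)%:E <= G y)%E) ->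
  ((r ^+ n * (r * l1norm z - k))%:E <= \int[leb]_(y in P) G y)%E.
Proof.
move=> r0 hr mG G0 zG; have [neg|pos] := leP (r * l1norm z - k) 0.
  apply: (@le_trans _ _ 0%E); last exact: integral_ge0.
  by rewrite lee_fin mulr_ge0_le0// exprn_ge0// ltW.
pose lo : 'rV[R]_n := \row_i (if 0 <= z ord0 i then r else - (2 * r)).
pose hi : 'rV[R]_n := \row_i (if 0 <= z ord0 i then 2 * r else - r).
have mB := measurable_box lo hi.
have BP : box lo hi `<=` P.
  move=> y By; apply: hr => i; have := By i; rewrite !mxE ler_norml.
  by case: ifP => _ /andP[h1 h2]; apply/andP; split; lra.
have leB : leb (box lo hi) = (r ^+ n)%:E.
  rewrite lebesgue_box => [|i]; last by rewrite !mxE; case: ifP => _; lra.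
  rewrite (eq_bigr (fun=> r)) ?prodr_const ?card_ord// => i _.
  by rewrite !mxE; case: ifP => _; ring.
apply: (@le_trans _ _ (\int[leb]_(y in box lo hi) (r * l1norm z - k)%:E)%E).
  by rewrite integral_cst//= mulrC EFinM -leB.
apply: (@le_trans _ _ (\int[leb]_(y in box lo hi) G y)%E); last first.
  by apply: ge0_subset_integral.
apply: ge0_le_integral => //.
- by move=> y _; rewrite lee_fin ltW.
- exact: measurable_funS mG.
- move=> y By; apply: (le_trans _ (zG _ (BP _ By))).
  rewrite lee_fin lerD2r /l1norm mulr_sumr ler_sum// => i _.
  have := By i; rewrite !mxE; case: ifPn => z0 /andP[h1 h2].
    by rewrite ger0_norm// mulrC ler_wpM2l.
  rewrite -ltNge in z0; rewrite ltr0_norm// mulrN -mulNr mulrC.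
  by rewrite ler_wnM2l// ltW.
Qed.

Lemma integral_exp_l1norm (e : R) a : 0 < e ->
  (\int[leb]_x (expR (- (e * l1norm (x - a))))%:E = ((2 / e) ^+ n)%:E)%E.
Proof.
move=> e0; pose f (i : 'I_n) (s : measurableTypeR R) := expR (- (e * `|s - a ord0 i|)).
transitivity (\int[leb]_x (\prod_(i < n) f i (x ord0 i))%:E)%E.
  apply: eq_integral => x _; congr EFin.
  rewrite /l1norm mulr_sumr -sumrN expR_sum; apply: eq_bigr => i _.
  by rewrite /f !mxE.
rewrite ge0_integral_rV_prod; last 2 first.
- move=> i; apply: continuous_measurable_fun => s.
  apply: continuous_comp; last exact: continuous_expR.
  apply: (@continuousN _ R^o); apply: continuousM; first exact: cst_continuous.
  apply: continuous_comp; last exact: norm_continuous.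
  by apply: (@continuousB _ R^o) => //; exact: cst_continuous.
- by move=> i s; exact: expR_ge0.
rewrite (eq_bigr (fun=> (2 / e)%:E)) => [|i _]; last exact: integral_exp_abs.
by rewrite prodEFin prodr_const card_ord.
Qed.

(** Since [phi^* >= - phi 0], the negative part of [phi^*] is bounded, and finiteness
    of the integral of [phi^*] controls the positive part. *)
Lemma integrable_legendre phi : E1 P phi -> leb.-integrable P (legendre phi).
Proof.
move=> [_ Foo]; set F := legendre phi in Foo *.
have mF : measurable_fun P F by exact: measurable_legendre.
have Fge y : ((- phi 0)%:E <= F y)%E.
  by have := legendre_ge phi 0 y; rewrite dot0l sub0r.
have iN : leb.-integrable P F^\-%E.
  have := bounded_measurable_integrable Pb (bounded_measurable_cst P `|phi 0|).
  apply: le_integrable => //; first exact: measurable_funeneg.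
  move=> y _; rewrite gee0_abs ?funeneg_ge0// /= normr_id funenegE ge_max.
  rewrite lee_fin normr_ge0 andbT leeNl (le_trans _ (Fge y))// -EFinN lee_fin.
  by rewrite lerN2 ler_norm.
have iP : leb.-integrable P F^\+%E.
  apply/integrableP; split; first exact: measurable_funepos.
  under eq_integral do rewrite gee0_abs ?funepos_ge0//.
  have iNf := integrable_fin_num mP iN.
  move: Foo; rewrite [X in (X < _)%E -> _]integralE -(fineK iNf).
  by rewrite lteBlDr.
by rewrite (funeposneg F); exact: integrableB.
Qed.

Section normalised.
Context (phi : 'rV[R]_n -> R) (phiE1 : E1 P phi) (x0 : 'rV[R]_n).

(** The Legendre transform of [phi (x0 + .) - phi x0]. *)
Definition normalised_legendre y : \bar R :=
  (legendre phi y - (dot x0 y - phi x0)%:E)%E.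

Let A y := dot x0 y - phi x0.
Let AA : is_affine A. Proof. exact: affine_dot. Qed.

Lemma normalised_legendre_ge0 y : (0 <= normalised_legendre y)%E.
Proof. by rewrite sube_ge0// legendre_ge. Qed.

Lemma integrable_normalised_legendre :
  leb.-integrable P normalised_legendre.
Proof.
apply: integrableB => //; first exact: integrable_legendre.
exact: (bounded_measurable_integrable Pb (bounded_measurable_affine Pb AA)).
Qed.

Definition energy : R := fine (\int[leb]_(y in P) normalised_legendre y).

Lemma energyE : (\int[leb]_(y in P) normalised_legendre y = energy%:E)%E.
Proof. by rewrite fineK//; exact: integrable_fin_num integrable_normalised_legendre. Qed.

Lemma energy_ge0 : 0 <= energy.
Proof.
by rewrite -lee_fin -energyE integral_ge0// => y _; exact: normalised_legendre_ge0.
Qed.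

(** Each value [phi x] gives the affine minorant [<x - x0, .> - (phi x - phi x0)] of
    the normalised transform; where it is large it contributes to the energy. *)
Lemma energy_growth (r : R) x : 0 < r ->
  (forall y, (forall i, `|y ord0 i| <= 2 * r) -> P y) ->
  r * l1norm (x - x0) - energy / r ^+ n <= phi x - phi x0.
Proof.
move=> r0 hr; rewrite lerBlDl -lerBlDr ler_pdivlMr ?exprn_gt0// mulrC -lee_fin -energyE.
apply: integral_orthant_ge => //.
- exact: (measurable_int leb integrable_normalised_legendre).
- by move=> y _; exact: normalised_legendre_ge0.
- move=> y _; apply: (le_trans _ (leeB (legendre_ge phi x y) (lexx _))).
  by rewrite -EFinB lee_fin dotDl dotNl; lra.
Qed.

Lemma JT_le_energy : (JT P (legendre phi) <= ((volume P)^-1 * energy)%:E)%E.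
Proof.
rewrite EFinM -energyE; apply: (JT_le (l := A)) => // y _.
exact: normalised_legendre_ge0.
Qed.

(** By [ricciE] the affine function subtracted from [phi^*] contributes exactly
    [- phi x0]. *)
Lemma integral_legendre_ricci_ge l : is_ricci_affine P l ->
  0 < inf (l @` P) ->
  ((inf (l @` P) * energy - phi x0)%:E <=
    \int[leb]_(y in P) (legendre phi y * (l y)%:E))%E.
Proof.
move=> l_ricci m0; set m := inf _ in m0 *.
have bl := ricci_bounded_measurable Pb l_ricci.
have bA := bounded_measurable_affine Pb AA.
have bAl := bounded_measurableM bA bl.
have iAl := bounded_measurable_integrable Pb bAl.
have imG := integrableZl mP m integrable_normalised_legendre.
have -> : (m * energy - phi x0)%:E =
    (\int[leb]_(y in P) (m%:E * normalised_legendre y + (A y * l y)%:E))%E.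
  rewrite integralD//= integral_EFin// (ricciE Pb l_ricci AA) /A dot0r sub0r.
  by rewrite integralZl ?integrable_normalised_legendre// energyE -EFinM -EFinD.
apply: (le_integral mP).
- exact: (integrableD mP imG iAl).
- apply: integrableMl => //; [exact: integrable_legendre|by case: bl|].
  have [_ [M hM]] := bl; exists M; split; first exact: num_real.
  by move=> N MN y /= Py; rewrite (le_trans (hM _ Py))// ltW.
- move=> y; rewrite inE => Py; have ml : m <= l y by exact: inf_le_ricci.
  have := legendre_ge phi x0 y; rewrite /normalised_legendre -/(A y).
  case: (legendre phi y) => [s| |//].
    rewrite lee_fin => As; rewrite -EFinB -!EFinM -EFinD lee_fin.
    by rewrite -subr_ge0 (_ : _ - _ = (s - A y) * (l y - m)) ?mulr_ge0 ?subr_ge0//; ring.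
  by move=> _; rewrite [leRHS]gt0_mulye ?leey// lte_fin (lt_le_trans m0).
Qed.

End normalised.

(** With [E] the energy at an almost minimum point [x0] of [phi],
    [D(phi) >= (m - t / r^n) E - C_t] for every [t] in (0, 1]: interpolating the
    growth estimate with the bound [phi >= phi x0 - 1] costs only the fraction [t]
    of the energy. *)
Lemma coercive_lt_inf l (delta : R) : is_ricci_affine P l -> 0 < delta ->
  delta < volume P * inf (l @` P) -> coercive_with P l delta.
Proof.
move=> l_ricci d0; set m := inf _ => dm; have V0 := volume_gt0 Pb.
have m0 : 0 < m by rewrite -(pmulr_rgt0 _ V0); exact: lt_trans dm.
have {dm}dm : 0 < m - delta / volume P by rewrite subr_gt0 ltr_pdivrMr// mulrC.
have [r r0 hr] : exists2 r, 0 < r &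
    forall y, (forall i, `|y ord0 i| <= 2 * r) -> P y.
  have [s s0 hs] := convex_body_interior Pb; exists (s / 4); first by rewrite divr_gt0.
  by move=> y hy; apply: hs => i; rewrite (le_lt_trans (hy i))//; lra.
pose k := r ^+ n; have k0 : 0 < k by rewrite exprn_gt0.
(* The loss [t E / k] has to fit into the gap between [m E] and [delta E / V]. *)
pose t := Num.min 1 (k * (m - delta / volume P)).
have t0 : 0 < t by rewrite lt_min ltr01 mulr_gt0.
have t1 : t <= 1 by rewrite ge_min lexx.
have tk : t / k <= m - delta / volume P.
  by rewrite ler_pdivrMr// mulrC ge_min lexx orbT.
have e0 : 0 < t * r by rewrite mulr_gt0.
pose K := (2 / (t * r)) ^+ n.
have K0 : 0 < K by rewrite exprn_gt0// divr_gt0.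
exists (1 + ln K) => phi phiE1.
(* An almost minimum suffices: the error [1] only enters the constant [C_t]. *)
have [x0 hx0] : exists x0, forall x, phi x0 - 1 <= phi x.
  have lb : has_inf (range phi).
    split; first by exists (phi 0), 0.
    exists (phi 0 - energy phi 0 / k) => _ [x _ <-].
    have := energy_growth phiE1 0 x r0 hr; rewrite -/k => h.
    have : 0 <= r * l1norm (x - 0) by rewrite mulr_ge0 ?sumr_ge0// ltW.
    lra.
  have [_ [x0 _ <-] h] := inf_adherent ltr01 lb.
  exists x0 => x; rewrite lerBlDr (le_trans (ltW h))// lerD2r.
  by apply: ge_inf; [case: lb|exists x].
set E := energy phi x0; have E0 : 0 <= E by exact: energy_ge0.
pose c := 1 + t * (E / k) - phi x0.
have Iexp : (\int[leb]_x (expR (- phi x))%:E <= (expR c * K)%:E)%E.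
  apply: (@le_trans _ _ (\int[leb]_x ((expR c)%:E *
      (expR (- (t * r * l1norm (x - x0))))%:E))%E).
    apply: ge0_le_integralT => x; first by rewrite lee_fin expR_ge0.
    rewrite -EFinM lee_fin -expRD ler_expR.
    have := energy_growth phiE1 x0 x r0 hr; rewrite -/k -/E => h.
    have : t * (r * l1norm (x - x0) - E / k + 1) <= 1 * (phi x - phi x0 + 1).
      have h1 : 0 <= phi x - phi x0 + 1 by have := hx0 x; lra.
      by rewrite (le_trans (ler_wpM2l (ltW t0) (lerD h (lexx 1))))// ler_wpM2r.
    rewrite /c mulrDr mulrBr mulrA; lra.
  rewrite ge0_integralZl//.
  - by rewrite integral_exp_l1norm// -EFinM.
  - apply/measurable_EFinP; apply: (measurableT_comp (@measurable_expR R)).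
    apply: (measurableT_comp (@oppr_measurable R setT)).
    apply: measurable_funM => //; apply: measurable_sum => i.
    under eq_fun do rewrite !mxE.
    apply: (measurable_fun_coord i (f := fun s => `|s - x0 ord0 i|)).
    apply: measurableT_comp; first exact: normr_measurable.
    by apply: measurable_funB.
have lnI : ((- (c + ln K))%:E <= - lne (\int[leb]_x (expR (- phi x))%:E))%E.
  rewrite EFinN leeN2 (le_trans (_ : _ <= lne (expR c * K)%:E)%E)//.
    rewrite lee_lne//; rewrite in_itv /= leey andbT.
      by apply: integral_ge0 => x _; rewrite lee_fin expR_ge0.
    by rewrite lee_fin mulr_ge0 ?expR_ge0// ltW.
  by rewrite lne_EFin ?mulr_gt0 ?expR_gt0// lnM ?posrE ?expR_gt0// expRK.
have FI := integral_legendre_ricci_ge phiE1 x0 l_ricci m0.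
rewrite -/m -/E in FI.
apply: (le_trans _ (leeD lnI FI)).
have JE := JT_le_energy phiE1 x0.
have dJ : (delta%:E * JT P (legendre phi) <= (delta * ((volume P)^-1 * E))%:E)%E.
  by rewrite EFinM lee_wpmul2l// lee_fin ltW.
apply: (le_trans (leeB dJ (lexx _))).
rewrite -EFinB -EFinD lee_fin.
have := ler_wpM2r E0 tk; rewrite mulrBl.
have -> : c = 1 + t / k * E - phi x0 by rewrite /c mulrA mulrAC.
rewrite mulrA; move: (t / k * E) (delta / volume P * E) => p q; lra.
Qed.

End coercivity.

(** * The equivalences and the thresholds *)

Lemma ereal_sup_threshold (R : realType) (M : R) (Q : R -> Prop) : 0 < M ->
  (forall d, 0 < d -> d < M -> Q d) -> (forall d, 0 < d -> Q d -> d <= M) ->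
  ereal_sup [set d%:E | d in [set d | 0 < d /\ Q d]] = M%:E.
Proof.
move=> M0 lo hi; apply/eqP; rewrite eq_le; apply/andP; split.
  by apply: ge_ereal_sup => _ [d [d0 Qd] <-]; rewrite lee_fin hi.
apply/lee_subgt0Pr => e e0.
have d0 : 0 < Num.max (M / 2) (M - e) by rewrite lt_max divr_gt0.
have dM : Num.max (M / 2) (M - e) < M.
  by rewrite gt_max; apply/andP; split; lra.
apply: (@le_trans _ _ (Num.max (M / 2) (M - e))%:E).
  by rewrite -EFinB lee_fin le_max lexx orbT.
apply: ereal_sup_ubound; exists (Num.max (M / 2) (M - e)) => //.
by split => //; exact: lo.
Qed.

Theorem corollary32 (R : realType) (n : nat) (n_gt0 : (0 < n)%N)
  (P : set 'rV[R]_n) (P_polytope : is_polytope P) (P0 : interior P 0)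
  (l : 'rV[R]_n -> R) (l_ricci : is_ricci_affine P l) :
  (coercive P l <-> uniformly_D_stable P l) /\
  (uniformly_D_stable P l <-> 0 < inf (l @` P)) /\
  (0 < inf (l @` P) ->
    coercivity_threshold P l = (volume P * inf (l @` P))%:E /\
    stability_threshold P l = (volume P * inf (l @` P))%:E).
Proof.
have Pb := polytope_convex_body P_polytope P0.
have V0 := volume_gt0 Pb.
have c_le d : 0 < d -> coercive_with P l d -> d <= volume P * inf (l @` P).
  by move=> /ltW d0; exact: coercive_inf_ge.
have s_le d : 0 < d -> D_stable_with P l d -> d <= volume P * inf (l @` P).
  by move=> /ltW d0; exact: D_stable_inf_ge.
have lt_c d : 0 < d -> d < volume P * inf (l @` P) -> coercive_with P l d.
  exact: coercive_lt_inf.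
have lt_s d : 0 < d -> d < volume P * inf (l @` P) -> D_stable_with P l d.
  by move=> /ltW d0 /ltW; exact: D_stable_le_inf.
have inf_gt0 d : 0 < d -> d <= volume P * inf (l @` P) -> 0 < inf (l @` P).
  by move=> d0 /(lt_le_trans d0); rewrite pmulr_rgt0.
have half : 0 < inf (l @` P) -> exists2 d, 0 < d & d < volume P * inf (l @` P).
  move=> m0; exists (volume P * inf (l @` P) / 2).
    by rewrite divr_gt0// mulr_gt0.
  by rewrite ltr_pdivrMr// ltr_pMr ?mulr_gt0// ltr1n.
have coerciveE : coercive P l <-> 0 < inf (l @` P).
  split=> [[d d0 /(c_le _ d0)]|/half[d d0 dm]]; first exact: inf_gt0.
  by exists d => //; exact: lt_c.
have stableE : uniformly_D_stable P l <-> 0 < inf (l @` P).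
  split=> [[d d0 /(s_le _ d0)]|/half[d d0 dm]]; first exact: inf_gt0.
  by exists d => //; exact: lt_s.
split; first exact: iff_trans coerciveE (iff_sym stableE).
split=> // m0; have Vm0 : 0 < volume P * inf (l @` P) by exact: mulr_gt0.
by split; apply: ereal_sup_threshold.
Qed.
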